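(* Let $d=1$ or $d\ge 3$. Let $P,U,\Theta:(0,\infty)\to\mathbb R$, with $P\ge0$ and $\Theta\ge0$, be the profile of a radially symmetric backward self-similar solution of the compressible Navier-Stokes system (cNS) in $\mathbb R^d$ (as described in the context), and identify $P,U,\Theta$ with the radial scalar functions $x\mapsto P(|x|),U(|x|),\Theta(|x|)$ on $\mathbb R^d$. If $$\Theta,\ P\Theta,\ P\Theta U,\ PU^2\in L^1(\mathbb R^d),\qquad U\in H^1(\mathbb R^d),\qquad \lim_{\varepsilon\to0}\varepsilon\int_{|x|\le\varepsilon^{-1}}P|U|^3\,dx=0,$$ then $U\equiv\Theta\equiv0$ and $P$ is constant.
   Context: The compressible Navier-Stokes system (cNS) for a density $\rho(t,x)$, velocity $u(t,x)\in\mathbb R^d$ and temperature $\theta(t,x)$, $x\in\mathbb R^d$, is $$\partial_t\rho+\mathrm{div}(\rho u)=0,$$ $$\partial_t(\rho u)+\mathrm{div}(\rho u\otimes u)+\nabla(\rho R\theta)=(\lambda+\mu)\nabla\mathrm{div}\,u+\mu\Delta u,$$ $$\partial_t\Big[\rho\Big(\tfrac{|u|^2}{2}+C_V\theta\Big)\Big]+\mathrm{div}\Big[u\Big(\rho\Big(\tfrac{|u|^2}{2}+C_V\theta\Big)+\rho R\theta\Big)\Big]-\kappa\Delta\theta=\mathrm{div}\big(\lambda(\mathrm{div}\,u)u+2\mu D(u)\cdot u\big),$$ where $D(u)=\frac12(\nabla u+(\nabla u)^T)$. The constants satisfy $C_V,R,\kappa,\mu>0$ and $2\mu+d\lambda\ge0$.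 A radially symmetric backward self-similar solution with profile $(P,U,\Theta)$ is a solution of (cNS) of the form $$\rho(t,x)=P\Big(\frac{r}{\sqrt{T-t}}\Big),\quad u(t,x)=\frac{1}{\sqrt{T-t}}\,U\Big(\frac{r}{\sqrt{T-t}}\Big)\frac{x}{r},\quad \theta(t,x)=\frac{1}{T-t}\,\Theta\Big(\frac{r}{\sqrt{T-t}}\Big),$$ with $T>0$, $r=|x|$. For functions of this form, (cNS) is equivalent to the following ordinary differential equations for $r>0$: $$\tfrac12 rP'+P'U+P\Big(U'+\tfrac{d-1}{r}U\Big)=0,$$ $$\tfrac12PU+\tfrac12r(PU)'+(PU^2)'+\tfrac{d-1}{r}PU^2+(PR\Theta)'=(2\mu+\lambda)\Big(U''+\tfrac{d-1}{r}U'-\tfrac{d-1}{r^2}U\Big),$$ $$PE+\tfrac12r(PE)'+\big(UPE+UPR\Theta\big)'+\tfrac{d-1}{r}\big(UPE+UPR\Theta\big)-\kappa\Big(\Theta''+\tfrac{d-1}{r}\Theta'\Big)$$ $$=2\mu\Big((U')^2+\tfrac{d-1}{r^2}U^2\Big)+\lambda\Big(U'+\tfrac{d-1}{r}U\Big)^2+(2\mu+\lambda)\Big(U''+\tfrac{d-1}{r}U'-\tfrac{d-1}{r^2}U\Big)U,$$ where $E=\frac{U^2}{2}+C_V\Theta$.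
   Formalization: Assumes 2μ+λ>0, automatic for d≥3; for d=1 with 2μ+λ=0 the claim fails (P=Θ=0, U any bump away from 0). ''Solution in R^d'' means the profile equations for r>0 together with (cNS) in the sense of distributions across x=0. *)

(* Defs.v *)
From HB Require Import structures.
From mathcomp Require Import all_boot all_order all_algebra.
From mathcomp Require Import all_classical all_reals all_analysis.

Set Implicit Arguments.
Unset Strict Implicit.
Unset Printing Implicit Defensive.

Import Order.TTheory GRing.Theory Num.Theory.
Import numFieldNormedType.Exports.

Local Open Scope classical_set_scope.
Local Open Scope ring_scope.

(** * Lebesgue measure on R^d

    The measure lives on [d.-tuple R] (product sigma-algebra) and is built by
    iterating the binary product measure; the topology and the derivatives live
    on ['rV[R]_d].  [rvec] is the coordinate identification of the two. *)

Section cons_measure.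
Context {R : realType} (n : nat).
Variable m : {sigma_finite_measure set (n.-tuple (measurableTypeR R)) -> \bar R}.

Definition cons_pair (p : measurableTypeR R * n.-tuple (measurableTypeR R)) :
  n.+1.-tuple (measurableTypeR R) := [tuple of p.1 :: p.2].

Let measurable_cons_pair : measurable_fun [set: measurableTypeR R * n.-tuple (measurableTypeR R)] cons_pair.
Proof. exact: measurable_cons. Qed.

Definition cons_measure : set (n.+1.-tuple (measurableTypeR R)) -> \bar R :=
  pushforward (@lebesgue_measure R \x m)%E cons_pair.

Let cons_measure0 : cons_measure set0 = 0%E.
Proof. exact: measure0. Qed.

Let cons_measure_ge0 A : (0 <= cons_measure A)%E.
Proof. exact: measure_ge0. Qed.

Let cons_measure_sigma_additive : semi_sigma_additive cons_measure.
Proof. exact: measure_semi_sigma_additive. Qed.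

HB.instance Definition _ := isMeasure.Build _ _ _ cons_measure
  cons_measure0 cons_measure_ge0 cons_measure_sigma_additive.

Let cons_measure_sigma_finite : sigma_finite [set: _] cons_measure.
Proof.
have /sigma_finiteP[F [UF ndF mF]] := sigma_finiteT (@lebesgue_measure R).
have /sigma_finiteP[G [UG ndG mG]] := sigma_finiteT m.
pose uncons (t : n.+1.-tuple (measurableTypeR R)) :
  measurableTypeR R * n.-tuple (measurableTypeR R) :=
  (thead t, [tuple of behead t]).
have muncons : measurable_fun [set: n.+1.-tuple (measurableTypeR R)] uncons.
  apply: measurable_fun_pair; first exact: measurable_tnth.
  exact: measurable_behead.
have consK p : uncons (cons_pair p) = p.
  by case: p => x t; rewrite /uncons/= theadE; congr pair; exact: val_inj.
exists (fun i => uncons @^-1` (F i `*` G i)).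
  apply/esym; rewrite -subTset => t _.
  have : [set: measurableTypeR R] (uncons t).1 by [].
  have : [set: n.-tuple (measurableTypeR R)] (uncons t).2 by [].
  rewrite UF UG => -[k _ Gk] [i _ Fi]; exists (maxn i k) => //; split.
  - by move: Fi; exact/subsetPset/ndF/leq_maxl.
  - by move: Gk; exact/subsetPset/ndG/leq_maxr.
move=> i; have [mFi Fioo] := mF i; have [mGi Gioo] := mG i; split.
  by rewrite -[X in measurable X]setTI; apply: muncons => //; exact: measurableX.
rewrite /cons_measure /pushforward.
rewrite [X in (_ X < _)%E](_ : _ = F i `*` G i); last first.
  by rewrite -[LHS]/[set p | (F i `*` G i) (uncons (cons_pair p))]; under eq_set do rewrite consK.
by rewrite product_measure1E// lte_mul_pinfty// ge0_fin_numE.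
Qed.

HB.instance Definition _ := Measure_isSigmaFinite.Build _ _ _ cons_measure
  cons_measure_sigma_finite.

End cons_measure.

Fixpoint leb (R : realType) (d : nat) :
    {sigma_finite_measure set (d.-tuple (measurableTypeR R)) -> \bar R} :=
  match d with
  | 0 => [the {sigma_finite_measure set _ -> \bar R} of
           @dirac _ (0.-tuple (measurableTypeR R)) [tuple] R]
  | d'.+1 => [the {sigma_finite_measure set _ -> \bar R} of
               cons_measure (leb R d')]
  end.

Lemma leb_box (R : realType) (d : nat) (A : 'I_d -> set (measurableTypeR R)) :
  (forall i, measurable (A i)) ->
  leb R d [set t | forall i, A i (tnth t i)] =
  (\prod_(i < d) @lebesgue_measure R (A i))%E.
Proof.
elim: d A => [|d IH] A mA.
  by rewrite big_ord0 /= diracE mem_set// => -[].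
rewrite big_ord_recl -(IH (fun i => A (lift ord0 i)))//.
set B := [set t : d.-tuple _ | _].
have mB : measurable B.
  rewrite (_ : B = \bigcap_(i in [set: 'I_d]) ((@tnth _ _)^~ i @^-1` A (lift ord0 i))).
    apply: fin_bigcap_measurable => // i _.
    rewrite -[X in measurable X]setTI; apply: measurable_tnth => //; exact: mA.
  by apply/seteqP; split => [t Bt i _|t Bt i]; [exact: Bt|exact: (Bt i)].
rewrite -(product_measure1E (@lebesgue_measure R) (leb R d) (mA ord0) mB).
rewrite /= /cons_measure /pushforward; congr (_ _).
apply/seteqP; split => -[x t] /=.
- by move=> H; split => [|i]; [exact: (H ord0)|have := H (lift ord0 i); rewrite tnthS].
- by move=> [Ax Bt] i; have [j ->|->//] := unliftP ord0 i; rewrite tnthS; exact: Bt.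
Qed.

Definition rvec (R : realType) (d : nat) (t : d.-tuple (measurableTypeR R)) :
  'rV[R]_d := \row_i tnth t i.

(** * Function spaces on R^d *)

Definition enorm (R : realType) (d : nat) (x : 'rV[R]_d) : R :=
  Num.sqrt (\sum_i x 0 i ^+ 2).

Definition L1 (R : realType) (d : nat) (f : 'rV[R]_d -> R) : Prop :=
  (leb R d).-integrable [set: d.-tuple (measurableTypeR R)]
    (fun t => (f (rvec t))%:E).

Definition L2 (R : realType) (d : nat) (f : 'rV[R]_d -> R) : Prop :=
  measurable_fun [set: d.-tuple (measurableTypeR R)] (fun t => f (rvec t)) /\
  L1 (fun x => f x ^+ 2).

(* On a finite-dimensional space this is the usual class C^k: the directional
   derivatives of order at most k exist and are continuous. *)
Fixpoint Ck (R : realType) (V : normedModType R) (k : nat) (f : V -> R) : Prop :=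
  match k with
  | 0 => continuous f
  | k'.+1 => continuous f /\
      forall v, (forall x, derivable f x v) /\ Ck k' (fun x => 'D_v f x)
  end.

(* C^oo functions with compact support in [D] *)
Definition test_fun (R : realType) (V : normedModType R) (D : set V)
    (phi : V -> R) : Prop :=
  (forall k, Ck k phi) /\
  exists K, [/\ compact K, K `<=` D & forall x, ~ K x -> phi x = 0].

Definition weak_partial (R : realType) (d : nat) (i : 'I_d)
    (f g : 'rV[R]_d -> R) : Prop :=
  forall phi, test_fun [set: 'rV[R]_d] phi ->
  (\int[leb R d]_t (f (rvec t) * 'D_(delta_mx 0 i) phi (rvec t))%:E =
   - \int[leb R d]_t (g (rvec t) * phi (rvec t))%:E)%E.

Definition H1 (R : realType) (d : nat) (f : 'rV[R]_d -> R) : Prop :=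
  L2 f /\ forall i, exists2 g, L2 g & weak_partial i f g.

(** * Solutions of (cNS) on ]0, T[ * R^d *)

Section cNS.
Context {R : realType} {d : nat}.

Local Notation st := (R * 'rV[R]_d)%type.

Definition stvec (z : measurableTypeR R * d.-tuple (measurableTypeR R)) : st :=
  (z.1, rvec z.2).

Definition L1loc (D : set st) (f : st -> R) : Prop :=
  forall K, compact K -> K `<=` D ->
  (@lebesgue_measure R \x leb R d)%E.-integrable (stvec @^-1` K)
    (fun z => (f (stvec z))%:E).

Definition dt (f : st -> R) (z : st) : R := 'D_((1, 0) : st) f z.
Definition dx (i : 'I_d) (f : st -> R) (z : st) : R :=
  'D_((0, delta_mx 0 i) : st) f z.
Definition lap (f : st -> R) (z : st) : R := \sum_i dx i (dx i f) z.

(* [tested D F]: the distribution phi |-> int F phi vanishes on [D]. *)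
Definition tested (D : set st) (F : (st -> R) -> st -> R) : Prop :=
  forall phi, test_fun D phi ->
  (\int[@lebesgue_measure R \x leb R d]_z (F phi (stvec z))%:E = 0)%E.

Variables (CV Rg kappa mu lambda : R).
Variables (rho : st -> R) (u : st -> 'rV[R]_d) (theta : st -> R).

Definition vel (i : 'I_d) (z : st) : R := u z 0 i.

Definition energy (z : st) : R :=
  rho z * ((\sum_i vel i z ^+ 2) / 2 + CV * theta z).

Definition energy_flux (i : 'I_d) (z : st) : R :=
  vel i z * (energy z + rho z * Rg * theta z).

Definition divu (z : st) : R := \sum_i dx i (vel i) z.

Definition Du (i j : 'I_d) (z : st) : R :=
  (dx j (vel i) z + dx i (vel j) z) / 2.

Definition visc_flux (i : 'I_d) (z : st) : R :=
  lambda * divu z * vel i z + 2 * mu * \sum_j Du i j z * vel j z.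

(* (cNS) in the sense of distributions on [D]: every term is locally integrable
   and all derivatives are put on the test function, except those of [u] inside
   [visc_flux], which are the pointwise ones; for the radial fields below they
   exist at every x <> 0, i.e. almost everywhere.  (A jump of [u] across x = 0,
   conceivable only for d = 1, is excluded by the momentum equation.) *)
Definition cNS_distr (D : set st) : Prop :=
  [/\ [/\ L1loc D rho, forall i, L1loc D (vel i) & L1loc D theta] /\
      [/\ forall i, L1loc D (fun z => rho z * vel i z),
          forall i j, L1loc D (fun z => rho z * vel i z * vel j z)
        & L1loc D (fun z => rho z * theta z)] /\
      [/\ L1loc D energy, forall i, L1loc D (energy_flux i)
        & forall i, L1loc D (visc_flux i)],
      tested D (fun phi z =>
        rho z * dt phi z + \sum_j rho z * vel j z * dx j phi z),
      forall i, tested D (fun phi z =>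
        rho z * vel i z * dt phi z
        + \sum_j rho z * vel i z * vel j z * dx j phi z
        + rho z * Rg * theta z * dx i phi z
        + (lambda + mu) * (\sum_j vel j z * dx j (dx i phi) z)
        + mu * (vel i z * lap phi z))
    & tested D (fun phi z =>
        energy z * dt phi z + \sum_j energy_flux j z * dx j phi z
        + kappa * (theta z * lap phi z)
        - \sum_j visc_flux j z * dx j phi z)].

End cNS.

(** * Radial backward self-similar solutions *)

Section selfsimilar.
Context {R : realType} (d : nat).
Variables (CV Rg kappa mu lambda : R).
Variables (T : R) (P U Th : R -> R).

Definition ss_rho (z : R * 'rV[R]_d) : R := P (enorm z.2 / Num.sqrt (T - z.1)).

Definition ss_u (z : R * 'rV[R]_d) : 'rV[R]_d :=
  (U (enorm z.2 / Num.sqrt (T - z.1)) / Num.sqrt (T - z.1))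
    *: ((enorm z.2)^-1 *: z.2).

Definition ss_theta (z : R * 'rV[R]_d) : R :=
  Th (enorm z.2 / Num.sqrt (T - z.1)) / (T - z.1).

Definition Etot (r : R) : R := U r ^+ 2 / 2 + CV * Th r.

Definition visc_op (r : R) : R :=
  derive1 (derive1 U) r + (d%:R - 1) / r * derive1 U r - (d%:R - 1) / r ^+ 2 * U r.

Definition profile_mass (r : R) : Prop :=
  r / 2 * derive1 P r + derive1 P r * U r
  + P r * (derive1 U r + (d%:R - 1) / r * U r) = 0.

Definition profile_momentum (r : R) : Prop :=
  P r * U r / 2 + r / 2 * derive1 (fun s => P s * U s) r
  + derive1 (fun s => P s * U s ^+ 2) r + (d%:R - 1) / r * (P r * U r ^+ 2)
  + derive1 (fun s => P s * Rg * Th s) r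
  = (2 * mu + lambda) * visc_op r.

Definition profile_energy (r : R) : Prop :=
  P r * Etot r + r / 2 * derive1 (fun s => P s * Etot s) r
  + derive1 (fun s => U s * P s * Etot s + U s * P s * Rg * Th s) r
  + (d%:R - 1) / r * (U r * P r * Etot r + U r * P r * Rg * Th r)
  - kappa * (derive1 (derive1 Th) r + (d%:R - 1) / r * derive1 Th r)
  = 2 * mu * (derive1 U r ^+ 2 + (d%:R - 1) / r ^+ 2 * U r ^+ 2)
    + lambda * (derive1 U r + (d%:R - 1) / r * U r) ^+ 2
    + (2 * mu + lambda) * visc_op r * U r.

(* [P, U, Th] only matter on ]0, +oo[.  For x <> 0 the fields solve (cNS)
   classically, which is the system of profile equations.  That system alone
   does not see the origin: for d = 1 it also has integrable solutions on
   ]0, +oo[ driven by fluxes through x = 0, which do not give solutions on the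
   whole line.  Being a solution on R^d is the distributional clause. *)
Definition selfsimilar_solution : Prop :=
  [/\ forall r, 0 < r ->
        [/\ derivable P r 1, derivable U r 1, derivable Th r 1,
            derivable (derive1 U) r 1 & derivable (derive1 Th) r 1],
      forall r, 0 < r ->
        [/\ profile_mass r, profile_momentum r & profile_energy r]
    & cNS_distr CV Rg kappa mu lambda ss_rho ss_u ss_theta
        [set z | 0 < z.1 < T]].

End selfsimilar.

(* Main.v *)
Require Import Defs.
From mathcomp Require Import all_boot all_order all_algebra.
From mathcomp Require Import all_classical all_reals all_analysis.
From mathcomp Require Import measurable_realfun.
From mathcomp Require Import ring lra.

(* Test the weak energy equation with a(t) eta(|x|^2 / (N^2 (T - t))), where a
   is a bump in time and eta is constant near 0.  In the variable
   y = x / sqrt (T - t) every term separates into a power of T - t times a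
   function of y, and integrating by parts in time leaves
     (d/2 - 1) int P E eta_N dy + (flux paired with the gradient of eta_N) = 0.
   The test function does not vanish near x = 0, so no boundary flux at the
   origin appears.  As N -> oo the flux terms vanish by the integrability
   hypotheses; in the viscous one U U' = (U^2)' / 2 is integrated by parts in
   the radius, so that only U in L^2 is needed.  Hence int P E = 0 as d <> 2,
   and P E = 0.  Then P U = 0 and the mass equation makes P constant.  If P = 0,
   the momentum and energy equations become linear: U = k r + b r^(1-d) and, once
   U = 0, Th = k + b r^(2-d) (k r + b if d = 1), none of which is integrable
   unless it is zero. *)

Set Implicit Arguments.
Unset Strict Implicit.
Unset Printing Implicit Defensive.

Import Order.TTheory GRing.Theory Num.Theory.
Import numFieldNormedType.Exports.

Local Open Scope classical_set_scope.
Local Open Scope ring_scope.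

(** * Lebesgue measure in R^d: scaling and radial functions *)

(** The factor d/2 - 1 is a scaling exponent: the energy per unit volume has size (T - t)^-1 and
    lives at length scale sqrt (T - t), so a finite total energy would vary like (T - t)^(d/2 - 1).
    Conservation contradicts this unless the energy is zero or d = 2.

    The obstacle is that nothing controls the profiles near the origin: they are regular on ]0, +oo[
    only, their value at 0 is arbitrary, and neither U U' nor P |U|^3 is known to be integrable
    there. Since eta is constant on [0, 1], every flux term is supported in the shell N <= |y| <= 2
    N, where all profiles are continuous, so each identity at fixed N involves finite integrals
    only. In the limit the flux P U^3 stands apart: it has no integrable majorant, but its
    coefficient has size 1/N, which is the weight eps of the cubic hypothesis at eps = 1/(2 N). All
    other terms have a majorant independent of N.

    Radial integration by parts is obtained by differentiating s |-> int over the ball of radius s,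
    in place of polar coordinates. *)

Definition radius (R : realType) (d : nat) (t : d.-tuple (measurableTypeR R)) : R :=
  enorm (rvec t).

Definition scale_tuple (R : realType) (d : nat) (c : R)
    (t : d.-tuple (measurableTypeR R)) : d.-tuple (measurableTypeR R) :=
  [tuple (c * tnth t i : measurableTypeR R) | i < d].

Lemma enorm_ge0 (R : realType) (d : nat) (x : 'rV[R]_d) : 0 <= enorm x.
Proof. exact: sqrtr_ge0. Qed.

Lemma radius_ge0 (R : realType) (d : nat) (t : d.-tuple (measurableTypeR R)) :
  0 <= radius t.
Proof. exact: enorm_ge0. Qed.

Lemma enorm_sqr (R : realType) (d : nat) (x : 'rV[R]_d) :
  enorm x ^+ 2 = \sum_i x 0 i ^+ 2.
Proof. by rewrite sqr_sqrtr// sumr_ge0// => i _; rewrite sqr_ge0. Qed.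

Lemma radius_sqr (R : realType) (d : nat) (t : d.-tuple (measurableTypeR R)) :
  radius t ^+ 2 = \sum_i (tnth t i : R) ^+ 2.
Proof. by rewrite enorm_sqr; apply: eq_bigr => i _; rewrite mxE. Qed.

Lemma radius_scale (R : realType) (d : nat) (c : R)
    (t : d.-tuple (measurableTypeR R)) : 0 <= c ->
  radius (scale_tuple c t) = c * radius t.
Proof.
move=> c0; apply: (@pexpIrn _ 2) => //; rewrite ?nnegrE ?radius_ge0 ?mulr_ge0 ?radius_ge0//.
rewrite exprMn !radius_sqr mulr_sumr; apply: eq_bigr => i _.
by rewrite tnth_mktuple exprMn.
Qed.

Lemma measurable_radius (R : realType) (d : nat) :
  measurable_fun [set: d.-tuple (measurableTypeR R)]
    (@radius R d : _ -> measurableTypeR R).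
Proof.
rewrite (_ : @radius R d = Num.sqrt \o (fun t => \sum_i (tnth t i : R) ^+ 2)); last first.
  apply/funext => t; rewrite /radius /enorm /=; congr Num.sqrt.
  by apply: eq_bigr => i _; rewrite mxE.
apply: measurableT_comp; first exact: (continuous_measurable_fun (@sqrt_continuous R)).
apply: measurable_sum => i; apply: measurable_funX.
exact: measurable_tnth.
Qed.

Lemma measurable_scale_tuple (R : realType) (d : nat) (c : R) :
  measurable_fun [set: d.-tuple (measurableTypeR R)] (@scale_tuple R d c).
Proof.
apply/measurable_fun_tnthP => i.
rewrite (_ : _ \o _ = fun t => c * tnth t i); last first.
  by apply/funext => t /=; rewrite tnth_mktuple.
by apply: measurable_funM => //; exact: measurable_tnth.
Qed.

(** The image of Lebesgue measure under x |-> c x, multiplied by c, agrees with Lebesgue measure on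
    the intervals ]a, b], hence everywhere by uniqueness. *)
Lemma ge0_integral_scale1 (R : realType) (c : R)
    (f : measurableTypeR R -> \bar R) : 0 < c ->
  measurable_fun setT f ->
  (forall x, 0 <= f x)%E ->
  (\int[@lebesgue_measure R]_x f (c * x)%R =
   (c^-1)%:E * \int[@lebesgue_measure R]_x f x)%E.
Proof.
move=> c0 mf f0.
have mc : measurable_fun [set: measurableTypeR R]
  ((fun x => c * x) : _ -> measurableTypeR R) by exact: measurable_funM.
pose nu := [the {measure set _ -> \bar R} of pushforward (@lebesgue_measure R) ((fun x => c * x) : _ -> measurableTypeR R)].
have c0' : (0 <= c) by exact: ltW.
pose mu := [the {measure set _ -> \bar R} of mscale (NngNum c0') (nu mc)].
have E A : measurable A -> @lebesgue_measure R A = mu A.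
  apply: lebesgue_measure_unique => _ [[a b] _ <-] /=.
  rewrite /mscale /nu /pushforward /=.
  rewrite (_ : pushforward _ _ _ = @lebesgue_measure R `]a/c, b/c]%classic); last first.
    rewrite /pushforward; congr (_ _).
    apply/seteqP; split => x /=; rewrite !in_itv/= ltr_pdivrMr// ler_pdivlMr//;
    by rewrite mulrC.
  rewrite !lebesgue_measure_itv/= !lte_fin ltr_pM2r ?invr_gt0//.
  case: ifP => _; last by rewrite mule0.
  by rewrite -!EFinB -EFinM -mulrBl mulrC divfK// gt_eqF.
rewrite [in RHS](eq_measure_integral mu); last by move=> A mA _; exact: E.
rewrite ge0_integral_mscale//= muleA -EFinM mulVf ?gt_eqF// mul1e.
by rewrite ge0_integral_pushforward//.
Qed.

Lemma scale_tuple_cons (R : realType) (d : nat) (c x : R) (t : d.-tuple (measurableTypeR R)) :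
  @scale_tuple R d.+1 c [tuple of (x : measurableTypeR R) :: t] =
  [tuple of (c * x : measurableTypeR R) :: scale_tuple c t].
Proof.
apply: eq_from_tnth => i; rewrite tnth_mktuple.
have [j ->|->] := unliftP ord0 i; last by rewrite !tnth0.
by rewrite !tnthS tnth_mktuple.
Qed.

Lemma ge0_integral_leb_cons (R : realType) (d : nat)
    (f : d.+1.-tuple (measurableTypeR R) -> \bar R) :
  measurable_fun setT f -> (forall t, 0 <= f t)%E ->
  (\int[leb R d.+1]_t f t =
   \int[@lebesgue_measure R]_x \int[leb R d]_t f [tuple of x :: t])%E.
Proof.
move=> mf f0.
have mcons : measurable_fun [set: measurableTypeR R * d.-tuple (measurableTypeR R)] (@cons_pair R d).
  exact: measurable_cons.
rewrite [LHS](@ge0_integral_pushforward _ _ _ _ _ _ mcons)//.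
rewrite preimage_setT.
rewrite (@fubini_tonelli1 _ _ _ _ _ (@lebesgue_measure R) (leb R d))//.
- exact: measurableT_comp.
- by move=> x; exact: f0.
Qed.

(** Tonelli and induction on the dimension: each coordinate contributes one factor c^-1. *)
Lemma ge0_integral_scale (R : realType) (d : nat) (c : R)
    (f : d.-tuple (measurableTypeR R) -> \bar R) : 0 < c ->
  measurable_fun setT f -> (forall t, 0 <= f t)%E ->
  (\int[leb R d]_t f (scale_tuple c t) =
   (c ^- d)%:E * \int[leb R d]_t f t)%E.
Proof.
move=> c0; elim: d f => [|d IH] f mf f0.
  rewrite expr0 invr1 mul1e; apply: eq_integral => t _.
  by congr f; rewrite [RHS]tuple0 [LHS]tuple0.
have mfs : measurable_fun setT (f \o @scale_tuple R d.+1 c).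
  by apply: measurableT_comp => //; exact: measurable_scale_tuple.
rewrite ge0_integral_leb_cons// [in RHS]ge0_integral_leb_cons//.
pose G (x : measurableTypeR R) := (\int[leb R d]_t f [tuple of (x : measurableTypeR R) :: t])%E.
have mcons : measurable_fun [set: measurableTypeR R * d.-tuple (measurableTypeR R)] (@cons_pair R d).
  exact: measurable_cons.
have mG : measurable_fun setT G.
  apply: (@measurable_fun_fubini_tonelli_F _ _ _ _ _ (leb R d) (f \o @cons_pair R d)) => //.
    exact: measurableT_comp.
  by move=> x; exact: f0.
transitivity (\int[@lebesgue_measure R]_x ((c ^- d)%:E * G (c * x)%R))%E.
  apply: eq_integral => x _.
  under eq_integral do rewrite scale_tuple_cons.
  rewrite (IH (fun t => f [tuple of (c * x : measurableTypeR R) :: t]))//.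
  apply: (measurableT_comp mf); apply: (measurable_cons (f:=cst (c * x : measurableTypeR R)) (g := id)) => //.
rewrite ge0_integralZl//; last 3 first.
- by apply: (measurableT_comp mG); exact: measurable_funM.
- by move=> x _; exact: integral_ge0.
- by rewrite lee_fin invr_ge0 exprn_ge0// ltW.
rewrite ge0_integral_scale1//; last by move=> x; exact: integral_ge0.
by rewrite muleA -EFinM -invfM -exprSr.
Qed.

Lemma measurable_radius_preimage (R : realType) (d : nat) (A : set R) :
  measurable (A : set (measurableTypeR R)) ->
  measurable [set t : d.-tuple (measurableTypeR R) | A (radius t)].
Proof.
by move=> mA; rewrite -[X in measurable X]setTI; exact: measurable_radius.
Qed.

(** A profile is continuous on ]0, +oo[ and arbitrary elsewhere. Freezing it at [f 0] on the
    nonpositive half-line restores measurability without changing it on [0, +oo[, where radii take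
    their values. *)
Lemma measurable_halfline (R : realType) (f : R -> R) :
  (forall r, 0 < r -> {for r, continuous f}) ->
  measurable_fun [set: measurableTypeR R]
    ((fun r => if 0 < r then f r else f 0) : measurableTypeR R -> measurableTypeR R).
Proof.
move=> cf.
have -> : [set: measurableTypeR R] = `]-oo, 0%R]%classic `|` `]0%R, +oo[%classic.
  apply/seteqP; split => // x _ /=; rewrite !in_itv/= andbT.
  by case: (leP x 0); [left|right].
apply/measurable_funU => //; split.
- apply: (eq_measurable_fun (cst (f 0))) => //.
  by move=> x; rewrite inE/= in_itv/= => x0; rewrite ltNge x0.
- apply: (eq_measurable_fun f).
    by move=> x; rewrite inE/= in_itv/= andbT => ->.
  apply: open_continuous_measurable_fun; first exact: interval_open.
  by move=> x; rewrite inE/= in_itv/= andbT; exact: cf.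
Qed.

Lemma measurable_comp_ge0 (R : realType) (d : measure_display) (X : measurableType d)
    (f : R -> R) (g : X -> measurableTypeR R) :
  (forall r, 0 < r -> {for r, continuous f}) -> measurable_fun setT g ->
  (forall x, 0 <= (g x : R)) -> measurable_fun setT (fun x => f (g x) : measurableTypeR R).
Proof.
move=> cf mg g0.
rewrite (_ : (fun x => _) = (fun r => if 0 < r then f r else f 0) \o g).
  by apply: measurableT_comp => //; exact: measurable_halfline.
apply/funext => x /=; have := g0 x.
by rewrite le_eqVlt => /predU1P[<-|->//]; rewrite ltxx.
Qed.

Lemma measurable_fun_radial (R : realType) (d : nat) (f : R -> R) :
  (forall r, 0 < r -> {for r, continuous f}) ->
  measurable_fun setT (fun t : d.-tuple (measurableTypeR R) => f (radius t)).
Proof.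
by move=> cf; apply: measurable_comp_ge0 => //; [exact: measurable_radius|exact: radius_ge0].
Qed.

Definition ball_vol (R : realType) (d : nat) : R :=
  fine (leb R d [set t | radius t <= 1]).

(** Only positivity and finiteness of the volume matter, so the ball is compared with two cubes:
    [0, 1/(d+1)]^d inside and [-1, 1]^d outside. The side 1/(d+1) also makes sense for d = 0. *)
Lemma leb_unit_ball_bounds (R : realType) (d : nat) :
  ((d.+1%:R^-1 ^+ d)%:E <= leb R d [set t | (radius t <= 1)%R] <= (2 ^+ d)%:E)%E.
Proof.
have itvE (a b : R) : a <= b -> @lebesgue_measure R `[a, b]%classic = (b - a)%:E.
  move=> ab; rewrite lebesgue_measure_itv/= lte_fin; case: ltP => // ba.
  by rewrite (_ : b = a) ?subrr//; apply: le_anti; rewrite ba.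
have mb : measurable [set t : d.-tuple (measurableTypeR R) | radius t <= 1].
  apply: (@measurable_radius_preimage _ _ [set x | x <= 1]).
  by rewrite -set_itvNyc; exact: measurable_itv.
have mbox (a b : R) : measurable [set t : d.-tuple (measurableTypeR R) | forall i, `[a, b]%classic (tnth t i)].
  rewrite (_ : [set _ | _] = \bigcap_(i in [set: 'I_d]) ((@tnth _ _)^~ i @^-1` `[a, b]%classic)).
    apply: fin_bigcap_measurable => // i _.
    rewrite -[X in measurable X]setTI; apply: measurable_tnth => //; exact: measurable_itv.
  by apply/seteqP; split => [t Bt i _|t Bt i]; [exact: Bt|exact: (Bt i)].
have box (a b : R) : a <= b ->
    leb R d [set t | forall i, `[a, b]%classic (tnth t i)] = ((b - a) ^+ d)%:E.
  move=> ab; rewrite (@leb_box R d (fun=> `[a, b]%classic)).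
    under eq_bigr do rewrite itvE//.
    by rewrite prodEFin prodr_const card_ord.
  by move=> i; exact: measurable_itv.
apply/andP; split.
- rewrite -[_^-1]subr0 -box ?invr_ge0//.
  apply: le_measure; rewrite ?inE// => t /= tb.
  rewrite -(@ler_pXn2r _ 2) ?nnegrE ?radius_ge0// expr1n radius_sqr.
  apply: (@le_trans _ _ (\sum_(i < d) d.+1%:R^-1)).
    apply: ler_sum => i _; have := tb i; rewrite in_itv/= => /andP[t0 t1].
    rewrite expr2; apply: (le_trans (ler_wpM2l t0 t1)).
    apply: ler_piMl; rewrite ?invr_ge0//.
    by apply: (le_trans t1); rewrite invf_le1 ?ltr0n// ler1n.
  by rewrite sumr_const card_ord -[leLHS]mulr_natl ler_pdivrMr ?ltr0n// mul1r ler_nat.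
- rewrite (_ : 2 = 1 - (-1) :> R); last by ring.
  rewrite -box; last by lra.
  apply: le_measure; rewrite ?inE// => t /= tb i.
  rewrite in_itv/= -ler_norml -(@ler_pXn2r _ 2) ?nnegrE// expr1n.
  rewrite real_normK ?num_real//.
  have := tb; rewrite -[radius t <= 1](@ler_pXn2r _ 2) ?nnegrE ?radius_ge0// expr1n radius_sqr.
  apply: le_trans; rewrite (bigD1 i)//= lerDl sumr_ge0// => j _.
  exact: sqr_ge0.
Qed.

Lemma leb_unit_ball (R : realType) (d : nat) :
  leb R d [set t | radius t <= 1] = (ball_vol R d)%:E.
Proof.
have /andP[h1 h2] := leb_unit_ball_bounds R d.
rewrite fineK// ge0_fin_numE//.
by apply: (le_lt_trans h2); rewrite ltry.
Qed.

Lemma ball_vol_gt0 (R : realType) (d : nat) : 0 < ball_vol R d.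
Proof.
have /andP[h1 _] := leb_unit_ball_bounds R d.
rewrite leb_unit_ball lee_fin in h1; apply: lt_le_trans h1.
by rewrite exprn_gt0// invr_gt0.
Qed.

Lemma leb_ball (R : realType) (d : nat) (b : R) : 0 < b ->
  leb R d [set t | radius t <= b] = (ball_vol R d * b ^+ d)%:E.
Proof.
move=> b0.
have mb (c : R) : measurable [set t : d.-tuple (measurableTypeR R) | radius t <= c].
  apply: (@measurable_radius_preimage _ _ [set x | x <= c]).
  by rewrite -set_itvNyc; exact: measurable_itv.
pose f (t : d.-tuple (measurableTypeR R)) : \bar R := (\1_[set t | radius t <= 1] t)%:E.
have mf : measurable_fun setT f by apply/measurable_EFinP; exact: measurable_indic.
have f0 t : (0 <= f t)%E by rewrite lee_fin.
have := @ge0_integral_scale R d b^-1 f.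
rewrite invr_gt0 => /(_ b0 mf f0).
rewrite [X in (_ * X)%E](_ : _ = (ball_vol R d)%:E); last first.
  by rewrite /f integral_indic// setIT; exact: leb_unit_ball.
rewrite -EFinM exprVn invrK mulrC => <-; rewrite /f.
rewrite -[X in leb R d X]setIT -integral_indic//; apply: eq_integral => t _.
rewrite !indicE; congr ((nat_of_bool _)%:R%:E); apply/idP/idP; rewrite !inE/= radius_scale ?invr_ge0 ?(ltW b0)//.
  by rewrite mulrC ler_pdivrMr// mul1r.
by rewrite mulrC ler_pdivrMr// mul1r.
Qed.

Lemma leb_shell (R : realType) (d : nat) (a b : R) : 0 < a -> a <= b ->
  leb R d [set t | a < radius t <= b] = (ball_vol R d * (b ^+ d - a ^+ d))%:E.
Proof.
move=> a0 ab.
have mb (c : R) : measurable [set t : d.-tuple (measurableTypeR R) | radius t <= c].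
  apply: (@measurable_radius_preimage _ _ [set x | x <= c]).
  by rewrite -set_itvNyc; exact: measurable_itv.
rewrite (_ : [set _ | _] = [set t | radius t <= b] `\` [set t | radius t <= a]); last first.
  apply/seteqP; split => t /=; first by move=> /andP[+ ->]; rewrite ltNge => /negP.
  by move=> [-> /negP]; rewrite -ltNge => ->.
rewrite measureD//; last by rewrite [ltLHS](leb_ball d (lt_le_trans a0 ab)) ltry.
rewrite setIC (_ : _ `&` _ = [set t | radius t <= a]); last first.
  by apply/setIidPl => t /= ta; exact: le_trans ab.
rewrite [X in (_ - X)%E](leb_ball d a0).
by rewrite [X in (X - _)%E](leb_ball d (lt_le_trans a0 ab)) -EFinB mulrBr.
Qed.

Lemma measurable_shell (R : realType) (d : nat) (a b : R) :
  measurable [set t : d.-tuple (measurableTypeR R) | a < radius t <= b].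
Proof.
apply: (@measurable_radius_preimage _ _ [set x | a < x <= b]).
by rewrite -set_itvoc; exact: measurable_itv.
Qed.

(** Makes the arbitrary values of the profiles at 0 invisible to integrals. For d = 0 the origin is
    the whole space and has mass 1. *)
Lemma leb_origin (R : realType) (d : nat) : (0 < d)%N ->
  leb R d [set t | radius t <= 0] = 0%E.
Proof.
move=> d0; apply/eqP; rewrite eq_le measure_ge0 andbT; apply/lee_addgt0Pr => e e0.
have v0 := ball_vol_gt0 R d.
pose b := Num.min 1 (e / ball_vol R d).
have b0 : 0 < b by rewrite lt_min ltr01 divr_gt0.
have mb (c : R) : measurable [set t : d.-tuple (measurableTypeR R) | radius t <= c].
  apply: (@measurable_radius_preimage _ _ [set x | x <= c]).
  by rewrite -set_itvNyc; exact: measurable_itv.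
apply: (@le_trans _ _ (leb R d [set t | radius t <= b])).
  by apply: le_measure; rewrite ?inE// => t /= /le_trans; apply; exact: ltW.
rewrite [X in (X <= _)%E](leb_ball d b0) add0e lee_fin mulrC -ler_pdivlMr//.
apply: (@le_trans _ _ b); last by rewrite ge_min lexx orbT.
rewrite -[X in _ <= X]expr1; apply: ler_wiXn2l => //; first exact: ltW.
by rewrite ge_min lexx.
Qed.

(** * Directional derivatives *)

Lemma is_deriveP (R : realType) (V : normedModType R) (f : V -> R) (x v : V) (l : R) :
  is_derive x v f l <-> h^-1 *: (f (h *: v + x) - f x) @[h --> 0^'] --> l.
Proof.
split=> [[dfx <-]|Hl].
  rewrite /derive; case/cvg_ex: dfx => l' Hl'.
  by rewrite (cvg_lim _ Hl').
apply: DeriveDef; first by apply/cvg_ex; exists l.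
exact: cvg_lim Hl.
Qed.

Section pointwise_derivation.
Context {R : realType} {V : normedModType R}.
Implicit Types (f g : V -> R) (x v : V).

Lemma is_derive_line f x v (l : R) :
  is_derive x v f l <-> is_derive (0 : R) (1 : R) (fun h : R => f (h *: v + x)) l.
Proof.
split => /is_deriveP H; apply/is_deriveP; move: H; apply: cvg_trans;
  apply: near_eq_cvg; apply: nearW => h; by rewrite scale0r add0r addr0 [_%:A]mulr1.
Qed.

Lemma is_derive_const (c : R) x v : is_derive x v (fun=> c) 0.
Proof. exact: is_derive_cst. Qed.

Lemma is_derive_add f g x v (df dg : R) :
  is_derive x v f df -> is_derive x v g dg ->
  is_derive x v (fun y => f y + g y) (df + dg).
Proof. exact: is_deriveD. Qed.

Lemma is_derive_opp f x v (df : R) :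
  is_derive x v f df -> is_derive x v (fun y => - f y) (- df).
Proof. exact: is_deriveN. Qed.

Lemma is_derive_sub f g x v (df dg : R) :
  is_derive x v f df -> is_derive x v g dg ->
  is_derive x v (fun y => f y - g y) (df - dg).
Proof. by move=> df_ dg_; apply: is_derive_add => //; exact: is_derive_opp. Qed.

Lemma is_derive_mul f g x v (df dg : R) :
  is_derive x v f df -> is_derive x v g dg ->
  is_derive x v (fun y => f y * g y) (df * g x + f x * dg).
Proof.
move=> df_ dg_; apply: (is_derive_eq (is_deriveM df_ dg_)).
by rewrite addrC mulrC.
Qed.

Lemma is_derive_cmul (c : R) f x v (df : R) :
  is_derive x v f df -> is_derive x v (fun y => c * f y) (c * df).
Proof. exact: is_deriveZ. Qed.

Lemma is_derive_pow f n x v (df : R) :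
  is_derive x v f df -> is_derive x v (fun y => f y ^+ n) (n%:R * f x ^+ n.-1 * df).
Proof.
move=> df_; rewrite (_ : (fun y => _) = f ^+ n); first exact: is_deriveX.
by elim: n => [|n IH]; [exact/funext|rewrite exprS -IH; apply/funext => y; rewrite exprS].
Qed.

Lemma is_derive_sum (I : Type) (r : seq I) (F : I -> V -> R) (dF : I -> R) x v :
  (forall i, is_derive x v (F i) (dF i)) ->
  is_derive x v (fun y => \sum_(i <- r) F i y) (\sum_(i <- r) dF i).
Proof.
move=> dF_; elim: r => [|i r IH].
  rewrite big_nil (_ : (fun y => _) = cst 0); first exact: is_derive_cst.
  by apply/funext => y; rewrite big_nil.
rewrite big_cons (_ : (fun y => _) = fun y => F i y + \sum_(j <- r) F j y).
  exact: is_derive_add.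
by apply/funext => y; rewrite big_cons.
Qed.

(** Only one directional derivative of [f] is available, so [f] is restricted to the line through
    [x] along [v], where the one-variable chain rule applies. *)
Lemma is_derive_chain (h : R -> R) f x v (dh df : R) :
  is_derive (f x) 1 h dh -> is_derive x v f df ->
  is_derive x v (fun y => h (f y)) (dh * df).
Proof.
move=> dh_ /is_derive_line df_; apply/is_derive_line.
by apply: is_derive1_comp; rewrite scale0r add0r.
Qed.

Lemma is_derive_inv f x v (df : R) : f x != 0 ->
  is_derive x v f df -> is_derive x v (fun y => (f y)^-1) (- (f x)^-2 * df).
Proof.
move=> fx0; apply: (is_derive_chain (h := GRing.inv)).
by apply: is_derive_eq; [exact: (is_deriveV fx0)|rewrite [_ *: _]mulr1].
Qed.

Lemma is_derive_near f g x v (df : R) :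
  (\near x, f x = g x) -> is_derive x v f df -> is_derive x v g df.
Proof.
move=> fg /is_deriveP H; apply/is_deriveP; move: H; apply: cvg_trans.
apply: near_eq_cvg.
have : \forall h \near (0 : R)^', f (h *: v + x) = g (h *: v + x).
  suff H : (h *: v + x) @[h --> (0:R)^'] --> x by exact: H fg.
  rewrite -[X in _ --> X]add0r -[X in _ --> X + _](scale0r v).
  apply: cvgD; last exact: cvg_cst.
  by apply: cvgZr_tmp; exact: cvg_within.
have fgx := nbhs_singleton fg.
by apply: filterS => h ->; rewrite fgx.
Qed.

End pointwise_derivation.

Lemma derivable_derive1 (R : realType) (f : R -> R) (x : R) :
  derivable f x 1 -> is_derive x 1 f (derive1 f x).
Proof. by move=> df; rewrite derive1E; exact: derivableP. Qed.

Lemma is_derive_continuous (R : realType) (f : R -> R) (x df : R) :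
  is_derive x 1 f df -> {for x, continuous f}.
Proof.
by move=> [df_ _]; apply: differentiable_continuous; exact/derivable1_diffP.
Qed.

Lemma is_derive0_cst (R : realType) (f : R -> R) :
  (forall x : R, 0 < x -> is_derive x 1 f 0) ->
  forall x y : R, 0 < x -> 0 < y -> f x = f y.
Proof.
move=> df.
suff H x y : 0 < x -> x <= y -> f x = f y.
  move=> x y x0 y0; have [xy|yx] := leP x y; first exact: H.
  by apply/esym; apply: H => //; exact: ltW.
move=> x0 xy.
have [||c _] := @MVT_segment R f (cst 0) x y xy.
- by move=> z; rewrite in_itv/= => /andP[xz _]; apply: df; exact: lt_trans xz.
- apply: continuous_in_subspaceT => z; rewrite inE/= in_itv/= => /andP[xz _].
  by apply: (@is_derive_continuous _ _ _ 0); apply: df; exact: lt_le_trans xz.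
by rewrite mul0r => /eqP; rewrite subr_eq0 => /eqP.
Qed.

(** * Radial integrals *)

Lemma integrable_radial_bounded (R : realType) (d : nat) (f : R -> R) (b M : R) :
  (forall r, 0 < r -> {for r, continuous f}) ->
  (forall r, 0 <= r -> `|f r| <= M) -> (forall r, b < r -> f r = 0) ->
  (leb R d).-integrable setT (fun t => (f (radius t))%:E).
Proof.
move=> cf fM fb.
have mb (c : R) : measurable [set t : d.-tuple (measurableTypeR R) | radius t <= c].
  apply: (@measurable_radius_preimage _ _ [set x | x <= c]).
  by rewrite -set_itvNyc; exact: measurable_itv.
pose c := Num.max b 1.
have c0 : 0 < c by rewrite lt_max ltr01 orbT.
apply/integrableP; split; first by apply/measurable_EFinP; exact: measurable_fun_radial.
apply: (@le_lt_trans _ _ (\int[leb R d]_t (M%:E * (\1_[set t | (radius t <= c)%R] t)%:E))%E).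
  apply: ge0_le_integral => //.
  - by apply/measurable_EFinP/measurableT_comp => //; exact: measurable_fun_radial.
  - apply: measurable_funeM; apply/measurable_EFinP; exact: measurable_indic.
  - move=> t _ /=; rewrite -EFinM lee_fin indicE.
    have [|tc] := boolP (t \in _); first by rewrite mulr1 fM ?radius_ge0.
    rewrite fb ?normr0 ?mulr0//.
    move: tc; rewrite notin_setE/= => /negP; rewrite -ltNge => /(le_lt_trans _); apply.
    by rewrite le_max lexx.
rewrite ge0_integralZl//; last 2 first.
- by apply/measurable_EFinP; exact: measurable_indic.
- by rewrite lee_fin (le_trans _ (fM 0 _)).
rewrite integral_indic// setIT [X in (_ * X)%E](leb_ball d c0) -EFinM ltry//.
Qed.

Lemma integrable_radial_compact (R : realType) (d : nat) (f : R -> R) (a b : R) :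
  0 < a -> a < b -> (forall r, 0 < r -> {for r, continuous f}) ->
  (forall r, 0 <= r <= a \/ b <= r -> f r = 0) ->
  (leb R d).-integrable setT (fun t => (f (radius t))%:E).
Proof.
move=> a0 ab cf f0.
have [c _ fc] : exists2 c, c \in `[a, b] & forall t, t \in `[a, b] -> `|f t| <= `|f c|.
  apply: (@EVT_max _ (fun x => `|f x|)); first exact: ltW.
  apply: continuous_in_subspaceT => r; rewrite inE/= in_itv/= => /andP[ar _].
  by apply: cvg_norm; apply: cf; exact: lt_le_trans ar.
apply: (@integrable_radial_bounded _ _ _ b `|f c|) => // [r r0|r /ltW br]; last first.
  by apply: f0; right.
have [ra|ra] := leP r a; first by rewrite f0 ?normr0//; left; rewrite r0.
have [rb|rb] := leP b r; first by rewrite f0 ?normr0//; right.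
by apply: fc; rewrite in_itv/= !ltW.
Qed.

(** The two ball integrals differ by the integral over the shell, on which [f] stays within [e] of
    the constant [c]; the volume of the shell is explicit. *)
Lemma radial_shell_estimate (R : realType) (d : nat) (f : R -> R) (r s c e : R) :
  (leb R d).-integrable setT (fun t => (f (radius t))%:E) ->
  0 < r -> r <= s -> (forall x, r < x <= s -> `|f x - c| <= e) ->
  `|\int[leb R d]_(t in [set t | radius t <= s]) f (radius t)
    - \int[leb R d]_(t in [set t | radius t <= r]) f (radius t)
    - c * (ball_vol R d * (s ^+ d - r ^+ d))|
  <= e * (ball_vol R d * (s ^+ d - r ^+ d)).
Proof.
move=> fi r0 rs fe.
have mb (a : R) : measurable [set t : d.-tuple (measurableTypeR R) | radius t <= a].
  apply: (@measurable_radius_preimage _ _ [set x | x <= a]).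
  by rewrite -set_itvNyc; exact: measurable_itv.
set S := [set t : d.-tuple (measurableTypeR R) | r < radius t <= s].
have mS : measurable S by exact: measurable_shell.
have volS : fine (leb R d S) = ball_vol R d * (s ^+ d - r ^+ d).
  by rewrite [leb R d S]leb_shell.
have leS : (leb R d S < +oo)%E by rewrite [X in (X < _)%E]leb_shell// ltry.
have fiS A : measurable A -> (leb R d).-integrable A (fun t => (f (radius t))%:E).
  by move=> mA; apply: integrableS fi.
have ciS (k : R) : (leb R d).-integrable S (fun t => k%:E).
  apply/integrableP; split; first exact: measurable_cst.
  by rewrite integral_cst//= lte_mul_pinfty// ?ge0_fin_numE//.
have -> : [set t : d.-tuple (measurableTypeR R) | radius t <= s] =
    [set t | radius t <= r] `|` S.
  apply/seteqP; split => t /=.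
    by move=> ts; have [tr|tr] := leP (radius t) r; [left|right; rewrite /S/= tr ts].
  by move=> [tr|/andP[]//]; exact: le_trans rs.
rewrite Rintegral_setU//; last 2 first.
- by apply: fiS; exact: measurableU.
- by apply/disj_setPS => t /= [tr /andP[]]; rewrite ltNge tr.
rewrite [X in `|X - _|]addrAC subrr add0r -volS.
rewrite -Rintegral_cst// -RintegralB; [|exact: mS|by apply: fiS|exact: ciS].
apply: le_trans (le_normr_Rintegral _ _) _ => //.
  apply: (@integrableB _ _ _ (leb R d) S mS (fun t => (f (radius t))%:E) (cst c%:E)) => //; [exact: fiS|exact: ciS].
rewrite -(@Rintegral_cst _ _ _ (leb R d) S)//; apply: le_Rintegral => //; [|exact: ciS|by move=> t /fe].
  have : (leb R d).-integrable S (fun t => ((f (radius t))%:E - c%:E)%E).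
    by apply: integrableB => //; exact: fiS.
  by move/integrable_abse.
Qed.

(** The role of polar coordinates: near radius [r] the ball integral grows like [f r] times the
    volume of the ball, by continuity of [f] at [r]. *)
Lemma is_derive_radial_integral (R : realType) (d : nat) (f : R -> R) (r : R) :
  (leb R d).-integrable setT (fun t => (f (radius t))%:E) ->
  0 < r -> {for r, continuous f} ->
  is_derive r 1
    (fun s => \int[leb R d]_(t in [set t | radius t <= s]) f (radius t))
    (f r * (ball_vol R d * (d%:R * r ^+ d.-1))).
Proof.
move=> fi r0 cf.
set H := (fun s => _).
pose V (s : R) := ball_vol R d * s ^+ d.
pose W (h : R) := h^-1 * (V (h + r) - V r).
set V' := ball_vol R d * _.
have WV : W h @[h --> 0^'] --> V'.
  have /is_deriveP : is_derive r 1 V V'.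
    apply: is_derive_cmul; rewrite -[X in is_derive _ _ _ X]mulr1.
    exact: (is_derive_pow d (is_derive_id r 1)).
  apply: cvg_trans; apply: near_eq_cvg; apply: nearW => h.
  by rewrite [_%:A]mulr1.
apply/is_deriveP.
pose E (h : R) := h^-1 * (H (h + r) - H r) - f r * W h.
(* [E] is the error made when the difference quotient is replaced by [f r] times that of the volume,
   whose limit is known. *)
suff E0 : E h @[h --> 0^'] --> 0.
  have : E h + f r * W h @[h --> (0:R)^'] --> 0 + f r * V'.
    by apply: cvgD => //; apply: cvgM => //; exact: cvg_cst.
  rewrite add0r; apply: cvg_trans; apply: near_eq_cvg; apply: nearW => h.
  by rewrite /E /= [_%:A]mulr1 subrK.
apply/cvgr0Pnorm_le => e e0.
pose M := `|V'| + 1.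
have M0 : 0 < M by rewrite ltr_wpDl.
have WM : \forall h \near (0 : R)^', `|W h| <= M.
  by apply: (cvgr_norm_le _ WV); rewrite ltrDl ltr01.
have := cf; move/cvgrPdist_le => /(_ (e / M) (divr_gt0 e0 M0)) /nbhs_ballP[del /= del0 fdel].
near=> h.
have hdel : `|h| < del.
  near: h; apply: dnbhs0_lt; exact: del0.
have hr : `|h| < r by near: h; apply: dnbhs0_lt.
have h0 : h != 0 by near: h; exact: nbhs_dnbhs_neq.
have hr0 : 0 < h + r.
  by move: hr; rewrite ltr_norml => /andP[h1 _]; lra.
have fe x : `|x - r| < del -> `|f x - f r| <= e / M.
  by move=> xr; rewrite distrC; apply: fdel; rewrite /ball/= distrC.
suff : `|H (h + r) - H r - f r * (V (h + r) - V r)| <= e / M * `|V (h + r) - V r|.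
  move=> HV; rewrite /E /W mulrCA -mulrBr normrM.
  apply: (@le_trans _ _ (`|h^-1| * (e / M * `|V (h + r) - V r|))).
    by rewrite ler_wpM2l.
  rewrite mulrCA -normrM -/(W h) -mulrA ler_piMr ?(ltW e0)// ler_pdivrMl// mulr1.
  by near: h.
have Vmono x y : 0 < x -> x <= y -> 0 <= V y - V x.
  move=> x0 xy; rewrite subr_ge0 /V ler_wpM2l ?(ltW (ball_vol_gt0 _ _))//.
  by rewrite lerXn2r ?nnegrE ?(ltW x0)// (le_trans (ltW x0)).
have [hp|hn] := leP 0 h.
  have rh : r <= h + r by rewrite lerDr.
  rewrite [X in _ <= _ * X]ger0_norm ?Vmono// /V -!mulrBr.
  apply: radial_shell_estimate => // x /andP[rx xh]; apply: fe.
  by rewrite ger0_norm ?subr_ge0 ?(ltW rx)//; move: hdel; rewrite ger0_norm//; lra.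
have rh : h + r <= r by rewrite gerDr ltW.
have -> : H (h + r) - H r - f r * (V (h + r) - V r) =
  - (H r - H (h + r) - f r * (V r - V (h + r))) by ring.
rewrite normrN [X in _ <= _ * X]distrC [X in _ <= _ * X]ger0_norm ?Vmono// /V -!mulrBr.
apply: radial_shell_estimate => // x /andP[rx xh]; apply: fe.
by rewrite ler0_norm ?subr_le0//; move: hdel; rewrite ltr0_norm//; lra.
Unshelve. all: by end_near. Qed.

(** The divergence theorem for the field with radial component h / r^(d-1). The integral of its
    divergence over the ball of radius s and d |B_1| h(s) have the same derivative in s; they agree
    at s = a, where both vanish, hence at s = b. *)
Lemma radial_integral_divergence (R : realType) (d : nat) (h h' : R -> R) (a b : R) :
  0 < a -> a < b ->
  (forall r : R, 0 < r -> is_derive r 1 h (h' r)) ->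
  (forall r, 0 < r -> {for r, continuous h'}) ->
  (forall r, 0 <= r <= a \/ b <= r -> h r = 0 /\ h' r = 0) ->
  (leb R d).-integrable setT (fun t => (h' (radius t) / radius t ^+ d.-1)%:E) ->
  \int[leb R d]_t (h' (radius t) / radius t ^+ d.-1) = 0.
Proof.
move=> a0 ab dh ch h0 fi.
pose f r := h' r / r ^+ d.-1.
pose H s := \int[leb R d]_(t in [set t | radius t <= s]) f (radius t).
pose c := ball_vol R d * d%:R.
have cf r : 0 < r -> {for r, continuous f}.
  move=> r0; apply: cvgM; first exact: ch.
  apply: cvgV; first by rewrite expf_neq0// gt_eqF.
  exact: exprn_continuous.
have dH (r : R) : 0 < r -> is_derive r 1 (fun s => H s - c * h s) 0.
  move=> r0.
  apply: (is_derive_eq (is_derive_sub (is_derive_radial_integral fi r0 (cf r r0)) (is_derive_cmul c (dh r r0)))).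
  rewrite /f /c.
  have ? : r ^+ d.-1 != 0 by rewrite expf_neq0// gt_eqF.
  by field.
have Ha : H a = 0.
  rewrite /H -[RHS](@Rintegral_set0 _ _ _ (leb R d) (fun t => f (radius t))).
  rewrite Rintegral_mkcond [RHS]Rintegral_mkcond; apply: eq_Rintegral => t _.
  rewrite !patchE in_set0; case: ifPn => //; rewrite inE/= => ta.
  by rewrite /f (h0 _ _).2 ?mul0r//; left; rewrite radius_ge0.
have := is_derive0_cst dH a0 (lt_trans a0 ab).
have aa : 0 <= a <= a by rewrite lexx ltW.
rewrite Ha (h0 a (or_introl aa)).1 (h0 b (or_intror (lexx _))).1 !mulr0 !subr0 => /esym Hb.
rewrite -[RHS]Hb /H [RHS]Rintegral_mkcond; apply: eq_Rintegral => t _.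
rewrite patchE; case: ifPn => //; rewrite notin_setE/= => /negP.
rewrite -ltNge => /ltW bt.
by rewrite (h0 _ (or_intror bt)).2 mul0r.
Qed.

(** * The smooth cut-off *)

(** The powers x^-n make the family exp(-1/x) x^-n stable under differentiation up to linear
    combinations, see [dflat], so smoothness of everything built from it follows by induction. *)
Definition flat (R : realType) (n : nat) (x : R) : R :=
  if 0 < x then x ^- n * expR (- x^-1) else 0.

Definition dflat (R : realType) (n : nat) (x : R) : R :=
  flat n.+2 x - n%:R * flat n.+1 x.

Section flat_functions.
Context {R : realType}.
Implicit Types x : R.

Lemma flat_ge0 n x : 0 <= flat n x.
Proof.
by rewrite /flat; case: ifP => // x0; rewrite mulr_ge0 ?expR_ge0// invr_ge0 exprn_ge0// ltW.
Qed.

Lemma flat0 n x : x <= 0 -> flat n x = 0.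
Proof. by rewrite /flat ltNge => ->. Qed.

(** From y^n / n! <= exp y at y = 1/x. *)
Lemma flat_le n x : flat n x <= n`!%:R.
Proof.
rewrite /flat; case: ifP => // x0; rewrite expRN -exprVn.
have y0 : 0 <= x^-1 by rewrite invr_ge0 ltW.
rewrite ler_pdivrMr ?expR_gt0//.
case: n => [|n]; first by rewrite expr0 fact0 mul1r -expR0 ler_expR.
have := expR_ge1Dxn n y0 => /(le_trans _) H.
have : x^-1 ^+ n.+1 / n.+1`!%:R <= expR x^-1 by apply: H; rewrite lerDr.
by rewrite ler_pdivrMr ?ltr0n ?fact_gt0// mulrC.
Qed.

(** At 0 this turns the difference quotient into h times a bounded function, so the derivative there
    is 0. *)
Lemma flat_sqr n x : flat n x = x ^+ 2 * flat n.+2 x.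
Proof.
rewrite /flat; case: ifPn => x0; last by rewrite mulr0.
rewrite mulrA; congr (_ * _).
have ? : x != 0 by rewrite gt_eqF.
have -> : x ^+ n.+2 = x ^+ 2 * x ^+ n by rewrite -exprD.
by rewrite invfM mulrA mulfV ?mul1r// expf_neq0.
Qed.

Lemma is_derive_flat n x : is_derive x 1 (@flat R n) (dflat n x).
Proof.
have [x0|x0|->] := ltgtP x 0.
- rewrite /dflat !flat0 ?(ltW x0)// mulr0 subr0.
  apply: (is_derive_near _ (is_derive_const (0 : R) x 1)).
  by apply: filterS (lt_nbhsl x0) => y y0; rewrite flat0// ltW.
- have x1 : x != 0 by rewrite gt_eqF.
  apply: (is_derive_near (f := fun y : R => (y^-1) ^+ n * expR (- y^-1))).
    by apply: filterS (lt_nbhsr x0) => y y0; rewrite /flat exprVn ifT.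
  have dV := is_derive_inv x1 (is_derive_id x (1:R)).
  have dE := is_derive_chain (f := fun y : R => - y^-1) (is_derive_expR (- x^-1)) (is_derive_opp dV).
  apply: (is_derive_eq (is_derive_mul (is_derive_pow n dV) dE)).
  rewrite /dflat /flat !ifT// -!exprVn.
  by case: n => [|n] /=; move: (x^-1) (expR _) => u E; rewrite ?exprS ?mul0r; ring.
- apply/is_deriveP; rewrite /dflat !flat0// mulr0 subr0.
  apply/cvgr0Pnorm_le => e e0.
  have C0 : 0 < n.+2`!%:R :> R by rewrite ltr0n fact_gt0.
  near=> h.
  have hne : h != 0 by near: h; exact: nbhs_dnbhs_neq.
  have he : `|h| < e / n.+2`!%:R by near: h; apply: dnbhs0_lt; rewrite divr_gt0.
  rewrite subr0 addr0 [_%:A]mulr1 flat_sqr /=.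
  rewrite (_ : _ *: _ = h * flat n.+2 h); last by rewrite /GRing.scale/=; field.
  rewrite normrM (ger0_norm (flat_ge0 _ _)).
  apply: (@le_trans _ _ (`|h| * n.+2`!%:R)); first by rewrite ler_wpM2l ?flat_le.
  by rewrite -ler_pdivlMr// ltW.
Unshelve. all: by end_near. Qed.

End flat_functions.

(** A composition instead of the usual quotient, so that no denominator has to be differentiated.
    The inner term [flat 0 (s - 1)] is 0 for s <= 1 and at least [flat 0 1] for s >= 2. The plateau
    value is exp(-e), not 1; only its positivity is used. *)
Definition eta (R : realType) (s : R) : R := flat 0 (flat 0 1 - flat 0 (s - 1)).

Definition deta (R : realType) (s : R) : R :=
  - (dflat 0 (flat 0 1 - flat 0 (s - 1)) * dflat 0 (s - 1)).

(** [dflat 0] is [flat 2], whose derivative is [dflat 2]. *)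
Definition ddeta (R : realType) (s : R) : R :=
  dflat 2 (flat 0 1 - flat 0 (s - 1)) * dflat 0 (s - 1) ^+ 2
  - dflat 0 (flat 0 1 - flat 0 (s - 1)) * dflat 2 (s - 1).

Section cutoff.
Context {R : realType}.
Implicit Types s : R.

Lemma dflat0E s : dflat 0 s = flat 2 s.
Proof. by rewrite /dflat mul0r subr0. Qed.

Lemma is_derive_eta s : is_derive s 1 (@eta R) (deta s).
Proof.
have ds : is_derive s 1 (fun y : R => y - 1) 1.
  by apply: (is_derive_eq (is_derive_sub (is_derive_id s 1) (is_derive_const 1 s 1))); rewrite subr0.
have d1 := is_derive_chain (f := fun y : R => y - 1) (is_derive_flat 0 (s - 1)) ds.
have d2 := is_derive_sub (is_derive_const (flat 0 1) s 1) d1.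
apply: (is_derive_eq (is_derive_chain (f := fun y : R => flat 0 1 - flat 0 (y - 1)) (is_derive_flat 0 _) d2)).
by rewrite /deta; ring.
Qed.

Lemma is_derive_deta s : is_derive s 1 (@deta R) (ddeta s).
Proof.
have ds : is_derive s 1 (fun y : R => y - 1) 1.
  by apply: (is_derive_eq (is_derive_sub (is_derive_id s 1) (is_derive_const 1 s 1))); rewrite subr0.
have d1 n := is_derive_chain (f := fun y : R => y - 1) (is_derive_flat n (s - 1)) ds.
have d2 := is_derive_sub (is_derive_const (flat 0 1) s 1) (d1 0%N).
have d3 := is_derive_chain (f := fun y : R => flat 0 1 - flat 0 (y - 1)) (is_derive_flat 2 _) d2.
have := is_derive_opp (is_derive_mul d3 (d1 2%N)).
rewrite (_ : (fun y => _) = @deta R); last by apply/funext => y; rewrite /deta !dflat0E.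
by move=> H; apply: (is_derive_eq H); rewrite /ddeta !dflat0E; ring.
Qed.

Lemma flat0_ge_1 s : 2 <= s -> flat 0 1 - flat 0 (s - 1) <= 0 :> R.
Proof.
move=> s2; rewrite subr_le0 /flat ltr01 ifT; last by lra.
rewrite !expr0 !invr1 !mul1r ler_expR lerN2 invf_le1; lra.
Qed.

Lemma eta_ge0 s : 0 <= eta s. Proof. exact: flat_ge0. Qed.

Lemma eta0_gt0 : 0 < eta (0 : R).
Proof.
rewrite /eta [flat 0 (0 - 1)]flat0 ?subr0; last by lra.
have f1 : 0 < flat 0 1 :> R.
  by rewrite /flat ltr01 expr0 invr1 mul1r expR_gt0.
by rewrite {1}/flat f1 expr0 invr1 mul1r expR_gt0.
Qed.

Lemma eta_le1 s : s <= 1 -> eta s = eta 0.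
Proof. by move=> s1; rewrite /eta !(@flat0 _ 0 (_ - 1))//; lra. Qed.

Lemma deta_le1 s : s <= 1 -> deta s = 0.
Proof.
move=> s1; have s1' : s - 1 <= 0 by lra.
by rewrite /deta [dflat 0 (s - 1)]dflat0E [flat 2 (s - 1)]flat0// mulr0 oppr0.
Qed.

Lemma ddeta_le1 s : s <= 1 -> ddeta s = 0.
Proof.
move=> s1; have s1' : s - 1 <= 0 by lra.
by rewrite /ddeta /dflat !(@flat0 _ _ (s - 1))//; ring.
Qed.

Lemma eta_ge2 s : 2 <= s -> eta s = 0.
Proof. by move=> /flat0_ge_1 s2; rewrite /eta flat0. Qed.

Lemma deta_ge2 s : 2 <= s -> deta s = 0.
Proof. by move=> /flat0_ge_1 s2; rewrite /deta dflat0E flat0// mul0r oppr0. Qed.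

Lemma ddeta_ge2 s : 2 <= s -> ddeta s = 0.
Proof.
move=> /flat0_ge_1 s2; by rewrite /ddeta /dflat !(@flat0 _ _ (flat 0 1 - _))//; ring.
Qed.

Lemma dflat_bound n s : `|dflat n s| <= (n.+2`! + n * n.+1`!)%:R.
Proof.
rewrite /dflat; apply: (le_trans (ler_normB _ _)); rewrite natrD natrM normrM.
by rewrite !ger0_norm ?flat_ge0// lerD ?flat_le// ler_wpM2l ?flat_le.
Qed.

Lemma eta_bounds : exists2 C : R, 0 < C &
  forall s, [/\ `|eta s| <= C, `|deta s| <= C & `|ddeta s| <= C].
Proof.
(* [dflat 0] is bounded by 2! = 2 and [dflat 2] by 4! + 2 * 3! = 36; the three groups bound [eta],
   [deta] and [ddeta]. *)
exists (1 + (2 * 2) + (36 * 4 + 2 * 36)) => [|s]; first by lra.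
have b0 x : `|dflat 0 x| <= 2 :> R by exact: (dflat_bound 0 x).
have b2 x : `|dflat 2 x| <= 36 :> R by exact: (dflat_bound 2 x).
split.
- rewrite ger0_norm ?eta_ge0//; apply: (@le_trans _ _ 1); last by lra.
  exact: (flat_le 0).
- rewrite /deta normrN normrM; apply: (@le_trans _ _ (2 * 2)); last by lra.
  exact: ler_pM.
- rewrite /ddeta; apply: (le_trans (ler_normB _ _)); rewrite !normrM.
  apply: (@le_trans _ _ (36 * 4 + 2 * 36)); last by lra.
  apply: lerD; last exact: ler_pM.
  by apply: ler_pM => //; rewrite (_ : 4 = 2 * 2); [exact: ler_pM|ring].
Qed.

End cutoff.

(* The existential form of [Ck] relative to an open set: unlike ['D_v f], the
   derivative [g] only has to be known on [D]. *)
Fixpoint Ck_on (R : realType) (V : normedModType R) (D : set V) (k : nat)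
    (f : V -> R) : Prop :=
  (forall x, D x -> {for x, continuous f}) /\
  match k with
  | 0 => True
  | k'.+1 => forall v, exists2 g, (forall x, D x -> is_derive x v f (g x)) & Ck_on D k' g
  end.

Section Ck_on_theory.
Context {R : realType} {V : normedModType R}.
Variable D : set V.
Hypothesis oD : open D.
Implicit Types f g : V -> R.

Lemma Ck_on_continuous k f : Ck_on D k f -> forall x, D x -> {for x, continuous f}.
Proof. by case: k => [|k] []. Qed.

Lemma Ck_on_pred k f : Ck_on D k.+1 f -> Ck_on D k f.
Proof.
elim: k f => [|k IH] f [cf df]; split=> // v.
by have [g dg /IH] := df v; exists g.
Qed.

Lemma Ck_on_eq k f g : (forall x, D x -> f x = g x) -> Ck_on D k f -> Ck_on D k g.
Proof.
have near_fg (a b : V -> R) x : (forall x, D x -> a x = b x) -> D x -> \near x, a x = b x.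
  move=> ab Dx; have : nbhs x D by apply: open_nbhs_nbhs; split.
  by apply: filterS => y; exact: ab.
have cont (a b : V -> R) : (forall x, D x -> a x = b x) ->
    (forall x, D x -> {for x, continuous a}) -> (forall x, D x -> {for x, continuous b}).
  move=> ab ca x Dx; have : a y @[y --> x] --> b x by rewrite -(ab _ Dx); exact: ca.
  by apply: cvg_trans; apply: near_eq_cvg; exact: near_fg.
case: k => [|k] fg [cf df]; split => //; try exact: cont cf.
move=> v; have [h dh ch] := df v; exists h => // x Dx.
by apply: is_derive_near (dh x Dx); exact: near_fg.
Qed.

Lemma Ck_on_cst k (c : R) : Ck_on D k (fun=> c).
Proof.
elim: k c => [|k IH] c; split => //; try by move=> x _; exact: cvg_cst.
move=> v; by exists (fun=> 0) => // x _; exact: is_derive_const.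
Qed.

Lemma Ck_on_add k f g : Ck_on D k f -> Ck_on D k g -> Ck_on D k (fun x => f x + g x).
Proof.
elim: k f g => [|k IH] f g [cf df] [cg dg]; split => //; try by move=> x Dx; apply: cvgD; [exact: cf|exact: cg].
move=> v; have [f' df' cf'] := df v; have [g' dg' cg'] := dg v.
exists (fun x => f' x + g' x); last exact: IH.
by move=> x Dx; apply: is_derive_add; [exact: df'|exact: dg'].
Qed.

Lemma Ck_on_mul k f g : Ck_on D k f -> Ck_on D k g -> Ck_on D k (fun x => f x * g x).
Proof.
elim: k f g => [|k IH] f g kf kg; split => //;
  try by move=> x Dx; apply: cvgM; [exact: Ck_on_continuous kf _ Dx|exact: Ck_on_continuous kg _ Dx].
move=> v; have [f' df' cf'] := kf.2 v; have [g' dg' cg'] := kg.2 v.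
exists (fun x => f' x * g x + f x * g' x).
  by move=> x Dx; apply: is_derive_mul; [exact: df'|exact: dg'].
by apply: Ck_on_add; apply: IH => //; exact: Ck_on_pred.
Qed.

Lemma Ck_on_opp k f : Ck_on D k f -> Ck_on D k (fun x => - f x).
Proof.
move=> kf; apply: (@Ck_on_eq _ (fun x => -1 * f x)) => [x _|]; first by rewrite mulN1r.
by apply: Ck_on_mul => //; exact: Ck_on_cst.
Qed.

Lemma Ck_on_sub k f g : Ck_on D k f -> Ck_on D k g -> Ck_on D k (fun x => f x - g x).
Proof. by move=> kf kg; apply: Ck_on_add => //; exact: Ck_on_opp. Qed.

Lemma Ck_on_sum k (I : Type) (r : seq I) (F : I -> V -> R) :
  (forall i, Ck_on D k (F i)) -> Ck_on D k (fun x => \sum_(i <- r) F i x).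
Proof.
move=> kF; elim: r => [|i r IH].
  by apply: (Ck_on_eq _ (Ck_on_cst k 0)) => x _; rewrite big_nil.
by apply: (Ck_on_eq _ (Ck_on_add (kF i) IH)) => x _; rewrite big_cons.
Qed.

Lemma Ck_on_affine k f (l : V -> R) : continuous f ->
  (forall x v, is_derive x v f (l v)) -> Ck_on D k f.
Proof.
move=> cf df; case: k => [|k]; split => //; try by move=> x _; exact: cf.
move=> v; by exists (fun=> l v) => [x _|]; [exact: df|exact: Ck_on_cst].
Qed.

Lemma Ck_on_inv k f : (forall x, D x -> f x != 0) -> Ck_on D k f ->
  Ck_on D k (fun x => (f x)^-1).
Proof.
move=> f0; elim: k => [|k IH] kf; split => //;
  try by move=> x Dx; apply: cvgV; [exact: f0|exact: Ck_on_continuous kf _ Dx].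
move=> v; have [f' df' cf'] := kf.2 v.
exists (fun x => - (f x)^-1 * (f x)^-1 * f' x).
  move=> x Dx; apply: (is_derive_eq (is_derive_inv (f0 x Dx) (df' x Dx))).
  by rewrite expr2 invfM !mulNr.
have := IH (Ck_on_pred kf) => kV.
by apply: Ck_on_mul => //; apply: Ck_on_mul => //; exact: Ck_on_opp.
Qed.

Lemma Ck_on_flat k n f : Ck_on D k f -> Ck_on D k (fun x => flat n (f x)).
Proof.
elim: k n f => [|k IH] n f kf; split => //.
1,2: move=> x Dx; apply: (@continuous_comp _ _ _ f (@flat R n)).
1,3: exact: Ck_on_continuous kf _ Dx.
1,2: exact: is_derive_continuous (is_derive_flat _ _).
move=> v; have [f' df' cf'] := kf.2 v.
exists (fun x => dflat n (f x) * f' x).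
  by move=> x Dx; apply: is_derive_chain; [exact: is_derive_flat|exact: df'].
have kf1 := Ck_on_pred kf.
apply: Ck_on_mul => //; apply: Ck_on_sub; first exact: IH.
by apply: Ck_on_mul; [exact: Ck_on_cst|exact: IH].
Qed.

Lemma Ck_on_eta k f : Ck_on D k f -> Ck_on D k (fun x => eta (f x)).
Proof.
move=> kf; apply: (Ck_on_flat 0); apply: Ck_on_sub; first exact: Ck_on_cst.
by apply: (Ck_on_flat 0); apply: Ck_on_sub => //; exact: Ck_on_cst.
Qed.

End Ck_on_theory.

(** On each open set the witness of [Ck_on] is forced to be ['D_v f], so the two local pieces glue.
    Meant for [cutoff], which is smooth by its formula before time T and identically 0 after t1 <
    T. *)
Lemma Ck_on_cover (R : realType) (V : normedModType R) (D1 D2 : set V) (k : nat)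
    (f : V -> R) :
  open D1 -> open D2 -> (forall x, D1 x \/ D2 x) ->
  Ck_on D1 k f -> Ck_on D2 k f -> Ck k f.
Proof.
move=> o1 o2 D12; elim: k f => [|k IH] f k1 k2.
  by move=> x; case: (D12 x); [exact: k1.1|exact: k2.1].
split; first by move=> x; case: (D12 x); [exact: k1.1|exact: k2.1].
move=> v; have [g1 dg1 kg1] := k1.2 v; have [g2 dg2 kg2] := k2.2 v.
split.
  by move=> x; case: (D12 x) => [/dg1|/dg2] [].
apply: IH.
- by apply: (Ck_on_eq o1 _ kg1) => x /dg1 [_ ->].
- by apply: (Ck_on_eq o2 _ kg2) => x /dg2 [_ ->].
Qed.

(** * Derivatives in space-time *)

Section spacetime_derivatives.
Context {R : realType} {d : nat}.
Local Notation st := (R * 'rV[R]_d)%type.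
Implicit Types z v : st.

Lemma is_derive_linear (V : normedModType R) (f : V -> R) (x v : V) :
  (forall h : R, f (h *: v + x) = h * f v + f x) -> is_derive x v f (f v).
Proof.
move=> flin; apply/is_deriveP.
suff : (fun=> f v) @ (0:R)^' --> f v.
  apply: cvg_trans; apply: near_eq_cvg; near=> h.
  have h0 : h != 0 by near: h; exact: nbhs_dnbhs_neq.
  by rewrite flin addrK [RHS]/GRing.scale/= mulrA mulVf// mul1r.
exact: cvg_cst.
Unshelve. all: by end_near. Qed.

Lemma is_derive_time z v : is_derive z v (fun w : st => w.1) v.1.
Proof. by apply: is_derive_linear. Qed.

Lemma is_derive_coord (i : 'I_d) z v : is_derive z v (fun w : st => w.2 0 i) (v.2 0 i).
Proof. by apply: (@is_derive_linear _ (fun w : st => w.2 0 i)) => h /=; rewrite !mxE. Qed.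

Lemma continuous_time : continuous (fun w : st => w.1).
Proof. by move=> z; exact: cvg_fst. Qed.

Lemma continuous_coord (i : 'I_d) : continuous (fun w : st => w.2 0 i).
Proof.
move=> z; apply: (@continuous_comp _ _ _ (snd : st -> _) (fun x : 'rV[R]_d => x 0 i)).
  exact: cvg_snd.
exact: coord_continuous.
Qed.

Lemma is_derive_enorm_sqr z v :
  is_derive z v (fun w : st => enorm w.2 ^+ 2) (\sum_i 2 * z.2 0 i * v.2 0 i).
Proof.
rewrite (_ : (fun w : st => _) = fun w : st => \sum_i w.2 0 i ^+ 2); last first.
  by apply/funext => w; rewrite enorm_sqr.
apply: is_derive_sum => i.
by apply: (is_derive_eq (is_derive_pow 2 (is_derive_coord i z v))); rewrite expr1.
Qed.

Lemma sum_delta (f : 'I_d -> R) (i : 'I_d) :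
  \sum_j f j * (delta_mx 0 i : 'rV[R]_d) 0 j = f i.
Proof.
rewrite (bigD1 i)//= mxE !eqxx mulr1 big1 ?addr0// => j ji.
by rewrite mxE (negbTE ji) andbF mulr0.
Qed.

End spacetime_derivatives.

(** * The space-time test function *)

Definition time_bump (R : realType) (t0 t1 t : R) : R := flat 0 (t - t0) * flat 0 (t1 - t).

Definition dtime_bump (R : realType) (t0 t1 t : R) : R :=
  dflat 0 (t - t0) * flat 0 (t1 - t) - flat 0 (t - t0) * dflat 0 (t1 - t).

Section bump_theory.
Context {R : realType}.
Variables t0 t1 : R.
Implicit Types t : R.

Lemma is_derive_bump t : is_derive t 1 (time_bump t0 t1) (dtime_bump t0 t1 t).
Proof.
have d0 : is_derive t 1 (fun y : R => y - t0) 1.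
  by apply: (is_derive_eq (is_derive_sub (is_derive_id t 1) (is_derive_const t0 t 1))); rewrite subr0.
have d1 : is_derive t 1 (fun y : R => t1 - y) (-1).
  by apply: (is_derive_eq (is_derive_sub (is_derive_const t1 t 1) (is_derive_id t 1))); rewrite sub0r.
apply: (is_derive_eq (is_derive_mul
  (is_derive_chain (f := fun y : R => y - t0) (is_derive_flat 0 (t - t0)) d0)
  (is_derive_chain (f := fun y : R => t1 - y) (is_derive_flat 0 (t1 - t)) d1))).
by rewrite /dtime_bump; ring.
Qed.

Lemma bump_out t : t <= t0 \/ t1 <= t -> time_bump t0 t1 t = 0 /\ dtime_bump t0 t1 t = 0.
Proof.
rewrite /time_bump /dtime_bump !dflat0E; case=> tt.
  by rewrite ![flat _ (t - t0)]flat0 ?subr_le0//; split; ring.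
by rewrite ![flat _ (t1 - t)]flat0 ?subr_le0//; split; ring.
Qed.

Lemma bump_ge0 t : 0 <= time_bump t0 t1 t.
Proof. by rewrite mulr_ge0 ?flat_ge0. Qed.

Lemma bump_gt0 t : t0 < t < t1 -> 0 < time_bump t0 t1 t.
Proof.
move=> /andP[tt0 tt1]; rewrite /time_bump /flat !ifT ?subr_gt0//.
by rewrite !expr0 invr1 !mul1r mulr_gt0 ?expR_gt0.
Qed.

Lemma continuous_bump : continuous (time_bump t0 t1).
Proof. by move=> t; exact: is_derive_continuous (is_derive_bump t). Qed.

Lemma continuous_dbump : continuous (dtime_bump t0 t1).
Proof.
move=> t; have cfl n x : {for x, continuous (@flat R n)}.
  exact: is_derive_continuous (is_derive_flat n x).
rewrite (_ : dtime_bump t0 t1 = fun t => flat 2 (t - t0) * flat 0 (t1 - t) - flat 0 (t - t0) * flat 2 (t1 - t)); last first.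
  by apply/funext => y; rewrite /dtime_bump !dflat0E.
have cl n : {for t, continuous (fun t => flat n (t - t0))}.
  apply: (@continuous_comp _ _ _ (fun t => t - t0) (flat n)); last exact: cfl.
  by apply: cvgB => //; exact: cvg_cst.
have cr n : {for t, continuous (fun t => flat n (t1 - t))}.
  apply: (@continuous_comp _ _ _ (fun t => t1 - t) (flat n)); last exact: cfl.
  by apply: cvgB => //; exact: cvg_cst.
by apply: cvgB; apply: cvgM; (exact: cl || exact: cr).
Qed.

End bump_theory.

Section test_function.
Context {R : realType} {d : nat}.
Local Notation st := (R * 'rV[R]_d)%type.
Variables (T t0 t1 N : R).
Hypotheses (t0_gt0 : 0 < t0) (t01 : t0 < t1) (t1T : t1 < T) (N0 : 0 < N).
Implicit Types z v : st.

(** The squared norm is polynomial in x, which keeps the test function smooth at x = 0. *)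
Definition sim (z : st) : R := enorm z.2 ^+ 2 / (N ^+ 2 * (T - z.1)).

Definition cutoff (z : st) : R := time_bump t0 t1 z.1 * eta (sim z).

Let open_time_lt (c : R) : open [set z : st | z.1 < c].
Proof.
apply: (@open_comp _ _ (fun z : st => z.1) [set t | t < c]); last exact: open_lt.
by move=> z _; exact: continuous_time.
Qed.

Let open_time_gt (c : R) : open [set z : st | c < z.1].
Proof.
apply: (@open_comp _ _ (fun z : st => z.1) [set t | c < t]); last exact: open_gt.
by move=> z _; exact: continuous_time.
Qed.

Let cover z : z.1 < T \/ t1 < z.1.
Proof. by case: (ltP z.1 T) => zT; [left|right; exact: lt_le_trans zT]. Qed.

Lemma is_derive_sim z v : z.1 < T ->
  is_derive z v sim ((\sum_i 2 * z.2 0 i * v.2 0 i) / (N ^+ 2 * (T - z.1))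
    + sim z * v.1 / (T - z.1)).
Proof.
move=> zT; have T0 : T - z.1 != 0 by rewrite gt_eqF// subr_gt0.
have Nn0 : N != 0 by rewrite gt_eqF.
have D0 : N ^+ 2 * (T - z.1) != 0 by rewrite mulf_neq0// expf_neq0.
have dT : is_derive z v (fun w : st => N ^+ 2 * (T - w.1)) (- (N ^+ 2 * v.1)).
  apply: (is_derive_eq (is_derive_cmul (N ^+ 2) (is_derive_sub (is_derive_const T z v) (is_derive_time z v)))).
  by ring.
apply: (is_derive_eq (is_derive_mul (is_derive_enorm_sqr z v)
  (is_derive_inv (f := fun w : st => N ^+ 2 * (T - w.1)) D0 dT))).
rewrite /sim; set S := \sum_i _; move: (enorm z.2) => e.
by field; rewrite T0 Nn0.
Qed.

Lemma Ck_cutoff k : Ck k cutoff.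
Proof.
apply: (@Ck_on_cover _ _ [set z : st | z.1 < T] [set z : st | t1 < z.1]) => //.
  have o := @open_time_lt T.
  have ktime : Ck_on [set z : st | z.1 < T] k (fun w : st => w.1).
    by apply: Ck_on_affine; [exact: continuous_time|exact: is_derive_time].
  have kc c := Ck_on_cst [set z : st | z.1 < T] k c.
  apply: Ck_on_mul.
    apply: Ck_on_mul; apply: (Ck_on_flat o 0); exact: (Ck_on_sub o).
  apply: (Ck_on_eta o); apply: Ck_on_mul.
    apply: (@Ck_on_eq _ _ _ o _ (fun w : st => \sum_i w.2 0 i * w.2 0 i)).
      by move=> w _; rewrite enorm_sqr; apply: eq_bigr => i _; rewrite expr2.
    apply: (Ck_on_sum o) => i.
    by apply: Ck_on_mul; (apply: Ck_on_affine; [exact: continuous_coord|exact: is_derive_coord]).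
  apply: (Ck_on_inv o).
    by move=> z /= zT; rewrite mulf_neq0 ?expf_neq0 ?gt_eqF ?subr_gt0.
  by apply: Ck_on_mul => //; exact: (Ck_on_sub o).
apply: (Ck_on_eq (@open_time_gt t1) _ (Ck_on_cst _ k 0)) => z /= /ltW tz.
by rewrite /cutoff (bump_out (or_intror tz)).1 mul0r.
Qed.

Lemma test_fun_cutoff : test_fun [set z : st | 0 < z.1 < T] cutoff.
Proof.
split; first exact: Ck_cutoff.
(* A coordinate with |x_i| > M gives |x|^2 >= M^2 >= M >= 2 N^2 (T - t), so [sim] is at least 2; the
   summand 1 ensures M <= M^2. *)
pose M := N ^+ 2 * T * 2 + 1.
have T0 : 0 < T by apply: lt_trans t1T; exact: lt_trans t01.
have M1 : 1 <= M by rewrite /M lerDr mulr_ge0// mulr_ge0 ?sqr_ge0// ltW.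
exists (`[t0, t1]%classic `*` [set x : 'rV[R]_d | forall i, `[-M, M]%classic (x 0 i)]); split.
- apply: compact_setX; first exact: segment_compact.
  by apply: (@rV_compact _ _ (fun=> `[-M, M]%classic)) => i; exact: segment_compact.
- move=> [t x] [/= ]; rewrite in_itv/= => /andP[tt0 tt1] _.
  by rewrite (lt_le_trans t0_gt0 tt0) (le_lt_trans tt1 t1T).
move=> [t x] /= nK; rewrite /cutoff/=.
have [tt0|tt0] := leP t t0; first by rewrite (bump_out (or_introl tt0)).1 mul0r.
have [tt1|tt1] := leP t1 t; first by rewrite (bump_out (or_intror tt1)).1 mul0r.
have zT : 0 < T - t by rewrite subr_gt0 (lt_trans tt1).
rewrite eta_ge2 ?mulr0// /sim/= ler_pdivlMr ?mulr_gt0 ?exprn_gt0//.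
have [i Mi] : exists i, M < `|x 0 i|.
  apply: contrapT => H; apply: nK; split.
    by rewrite in_itv/= !ltW.
  move=> i; rewrite in_itv/= -ler_norml leNgt; apply/negP => Mi.
  by apply: H; exists i.
have Mx : M <= `|x 0 i| ^+ 2.
  rewrite (le_trans (ltW Mi))// expr2 ler_peMl//.
  exact: le_trans (ltW Mi).
apply: (@le_trans _ _ M); last first.
  rewrite (le_trans Mx)// enorm_sqr (bigD1 i)//= real_normK ?num_real//.
  by rewrite lerDl sumr_ge0// => j _; exact: sqr_ge0.
rewrite /M; apply: (@le_trans _ _ (N ^+ 2 * T * 2)); last by rewrite lerDl.
rewrite mulrC ler_wpM2r// ler_wpM2l ?sqr_ge0// gerBl.
by rewrite ltW// (lt_trans t0_gt0).
Qed.

Lemma dt_cutoff z : dt cutoff z = dtime_bump t0 t1 z.1 * eta (sim z)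
  + time_bump t0 t1 z.1 * (deta (sim z) * sim z / (T - z.1)).
Proof.
have [zT|tz] := cover z.
  rewrite /dt; apply: derive_val.
  apply: (is_derive_eq (is_derive_mul
    (is_derive_chain (f := fun w : st => w.1) (is_derive_bump t0 t1 z.1) (is_derive_time z (1, 0)))
    (is_derive_chain (f := sim) (is_derive_eta (sim z)) (is_derive_sim (1, 0) zT)))).
  rewrite /= big1; first by ring.
  by move=> i _; rewrite mxE mulr0.
(* Past t1 the cut-off is locally 0 and the right-hand side vanishes with the bump, whatever
   [(T - z.1)^-1] is worth. *)
have [b0 b1] := @bump_out _ t0 t1 _ (or_intror (ltW tz)).
rewrite b0 b1 !mul0r addr0 /dt; apply: derive_val.
apply: (is_derive_near _ (is_derive_const (0 : R) z _)).
have : nbhs z [set z : st | t1 < z.1] by apply: open_nbhs_nbhs; split.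
by apply: filterS => w /= /ltW tw; rewrite /cutoff (bump_out (or_intror tw)).1 mul0r.
Qed.

Lemma dx_cutoff i z : dx i cutoff z =
  time_bump t0 t1 z.1 * (deta (sim z) * (2 * z.2 0 i / (N ^+ 2 * (T - z.1)))).
Proof.
have [zT|tz] := cover z.
  rewrite /dx; apply: derive_val.
  apply: (is_derive_eq (is_derive_mul
    (is_derive_chain (f := fun w : st => w.1) (is_derive_bump t0 t1 z.1) (is_derive_time z (0, delta_mx 0 i)))
    (is_derive_chain (f := sim) (is_derive_eta (sim z)) (is_derive_sim (0, delta_mx 0 i) zT)))).
  by rewrite /= sum_delta; ring.
have [b0 b1] := @bump_out _ t0 t1 _ (or_intror (ltW tz)).
rewrite b0 !mul0r /dx; apply: derive_val.
apply: (is_derive_near _ (is_derive_const (0 : R) z _)).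
have : nbhs z [set z : st | t1 < z.1] by apply: open_nbhs_nbhs; split.
by apply: filterS => w /= /ltW tw; rewrite /cutoff (bump_out (or_intror tw)).1 mul0r.
Qed.

Lemma dxx_cutoff i z : dx i (dx i cutoff) z =
  time_bump t0 t1 z.1 * (ddeta (sim z) * (2 * z.2 0 i / (N ^+ 2 * (T - z.1))) ^+ 2
    + deta (sim z) * (2 / (N ^+ 2 * (T - z.1)))).
Proof.
rewrite (_ : dx i cutoff = fun z => time_bump t0 t1 z.1 * (deta (sim z) * (2 * z.2 0 i / (N ^+ 2 * (T - z.1))))); last first.
  by apply/funext => w; exact: dx_cutoff.
have [zT|tz] := cover z.
  rewrite /dx; apply: derive_val.
  have dz := is_derive_sim (0, delta_mx 0 i) zT.
  have dT : is_derive z (0, delta_mx 0 i) (fun w : st => (N ^+ 2 * (T - w.1))^-1) 0.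
    have D0 : N ^+ 2 * (T - z.1) != 0.
      by rewrite mulf_neq0 ?expf_neq0 ?gt_eqF ?subr_gt0.
    have dD : is_derive z (0, delta_mx 0 i) (fun w : st => N ^+ 2 * (T - w.1)) 0.
      apply: (is_derive_eq (is_derive_cmul (N ^+ 2) (is_derive_sub (is_derive_const T z _) (is_derive_time z _)))).
      by rewrite /=; ring.
    by apply: (is_derive_eq (is_derive_inv (f := fun w : st => N ^+ 2 * (T - w.1)) D0 dD)); rewrite mulr0.
  apply: (is_derive_eq (is_derive_mul
    (is_derive_chain (f := fun w : st => w.1) (is_derive_bump t0 t1 z.1) (is_derive_time z (0, delta_mx 0 i)))
    (is_derive_mul (is_derive_chain (f := sim) (is_derive_deta (sim z)) dz)
      (is_derive_mul (is_derive_cmul 2 (is_derive_coord i z (0, delta_mx 0 i))) dT)))).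
  rewrite /= sum_delta mxE !eqxx /=.
  by ring.
have [b0 b1] := @bump_out _ t0 t1 _ (or_intror (ltW tz)).
rewrite b0 !mul0r /dx; apply: derive_val.
apply: (is_derive_near _ (is_derive_const (0 : R) z _)).
have : nbhs z [set z : st | t1 < z.1] by apply: open_nbhs_nbhs; split.
by apply: filterS => w /= /ltW tw; rewrite (bump_out (or_intror tw)).1 mul0r.
Qed.

Lemma lap_cutoff z : lap cutoff z =
  time_bump t0 t1 z.1 * ((4 * sim z * ddeta (sim z) + 2 * d%:R * deta (sim z))
    / (N ^+ 2 * (T - z.1))).
Proof.
rewrite /lap; under eq_bigr do rewrite dxx_cutoff.
rewrite -mulr_sumr; congr (_ * _).
rewrite big_split/= sumr_const card_ord -mulr_sumr.
rewrite (_ : \sum_i _ = 4 * sim z / (N ^+ 2 * (T - z.1))); last first.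
  under eq_bigr do rewrite !exprMn.
  rewrite -mulr_suml -mulr_sumr -enorm_sqr /sim.
  by move: (_ ^-1) => e; ring.
rewrite -[_ *+ d]mulr_natl.
by move: (_ ^-1) => e; ring.
Qed.

End test_function.

(** * The energy equation in self-similar variables *)

Section selfsimilar_fields.
Context {R : realType} {d : nat}.
Local Notation st := (R * 'rV[R]_d)%type.
Variables (CV Rg kappa mu lambda T : R) (P U Th : R -> R).
Implicit Types z : st.

Let rho : st -> R := ss_rho T P.
Let u : st -> 'rV[R]_d := ss_u T U.
Let theta : st -> R := ss_theta T Th.

Definition simvar (z : st) : R := enorm z.2 / Num.sqrt (T - z.1).

Lemma velE j z : vel u j z =
  U (simvar z) / Num.sqrt (T - z.1) * ((enorm z.2)^-1 * z.2 0 j).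
Proof. by rewrite /vel /u /ss_u !mxE. Qed.

Lemma vel0 j z : enorm z.2 = 0 -> vel u j z = 0.
Proof. by move=> z0; rewrite velE z0 invr0 mul0r mulr0. Qed.

Lemma is_derive_enorm z (v : st) : 0 < enorm z.2 ->
  is_derive z v (fun w : st => enorm w.2) ((\sum_i z.2 0 i * v.2 0 i) / enorm z.2).
Proof.
move=> r0; have r20 : 0 < enorm z.2 ^+ 2 by rewrite exprn_gt0.
rewrite (_ : (fun w : st => _) = fun w : st => Num.sqrt (enorm w.2 ^+ 2)); last first.
  by apply/funext => w; rewrite sqrtr_sqr ger0_norm ?enorm_ge0.
apply: (is_derive_eq (is_derive_chain (f := fun w : st => enorm w.2 ^+ 2)
  (is_derive1_sqrt r20) (is_derive_enorm_sqr z v))).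
rewrite sqrtr_sqr ger0_norm ?enorm_ge0//.
under eq_bigr do rewrite -mulrA.
by rewrite -mulr_sumr; field; rewrite gt_eqF.
Qed.

Hypothesis dU : forall r : R, 0 < r -> derivable U r 1.

(** The Jacobian of a radial field acts as U' on the line spanned by x and as U / r on its
    orthogonal complement, up to powers of T - t. *)
Lemma dx_velE i j z : z.1 < T -> 0 < enorm z.2 ->
  dx i (vel u j) z =
  z.2 0 i * z.2 0 j / enorm z.2 ^+ 2
    * (derive1 U (simvar z) / (T - z.1)
       - U (simvar z) / (Num.sqrt (T - z.1) * enorm z.2))
  + (i == j)%:R * (U (simvar z) / (Num.sqrt (T - z.1) * enorm z.2)).
Proof.
move=> zT r0; have T0 : 0 < T - z.1 by rewrite subr_gt0.
have s0 : 0 < Num.sqrt (T - z.1) by rewrite sqrtr_gt0.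
have sE : Num.sqrt (T - z.1) ^+ 2 = T - z.1 by rewrite sqr_sqrtr// ltW.
have y0 : 0 < simvar z by rewrite divr_gt0.
pose v : st := (0, delta_mx 0 i).
have ds : is_derive z v (fun w : st => (Num.sqrt (T - w.1))^-1) 0.
  have dT := is_derive_sub (is_derive_const T z v) (is_derive_time z v).
  have dsq := is_derive_chain (f := fun w : st => T - w.1) (is_derive1_sqrt T0) dT.
  apply: (is_derive_eq (is_derive_inv (f := fun w : st => Num.sqrt (T - w.1)) _ dsq)).
    by rewrite gt_eqF.
  by rewrite /= subr0 !mulr0.
have dr : is_derive z v (fun w : st => enorm w.2) (z.2 0 i / enorm z.2).
  by apply: (is_derive_eq (is_derive_enorm v r0)); rewrite sum_delta.
have dy : is_derive z v simvar (z.2 0 i / enorm z.2 / Num.sqrt (T - z.1)).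
  by apply: (is_derive_eq (is_derive_mul dr ds)); rewrite mulr0 addr0.
have r1 : enorm z.2 != 0 by rewrite gt_eqF.
have s1 : Num.sqrt (T - z.1) != 0 by rewrite gt_eqF.
rewrite /dx (_ : vel u j = fun w : st => U (simvar w) * (Num.sqrt (T - w.1))^-1
   * ((enorm w.2)^-1 * w.2 0 j)); last by apply/funext => w; rewrite velE.
apply: derive_val; apply: (is_derive_eq (is_derive_mul (is_derive_mul
  (is_derive_chain (f := simvar) (derivable_derive1 (dU y0)) dy) ds)
  (is_derive_mul (is_derive_inv (f := fun w : st => enorm w.2) r1 dr) (is_derive_coord j z v)))).
rewrite /v/= mxE eqxx/= [j == i]eq_sym.
move: s1 sE; set s' := Num.sqrt _ => s1 <-.
move: s' s1 (enorm z.2) r1 (U _) (derive1 U _) (_ %:R) => s s1 r r1 *.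
by field; rewrite r1 s1.
Qed.

Lemma divuE z : z.1 < T -> 0 < enorm z.2 ->
  divu u z = derive1 U (simvar z) / (T - z.1)
    + (d%:R - 1) * (U (simvar z) / (Num.sqrt (T - z.1) * enorm z.2)).
Proof.
move=> zT r0; rewrite /divu; under eq_bigr do rewrite dx_velE// eqxx mul1r -expr2.
rewrite big_split/= sumr_const card_ord -!mulr_suml -enorm_sqr -[_ *+ d]mulr_natl.
by rewrite divff ?expf_neq0 ?gt_eqF//; ring.
Qed.

(** u is parallel to x, an eigenvector of D(u) with eigenvalue U' / (T - t), so D(u) u is a multiple
    of u. *)
Lemma visc_fluxE i z : z.1 < T -> 0 < enorm z.2 ->
  visc_flux mu lambda u i z = vel u i z *
    (lambda * divu u z + 2 * mu * (derive1 U (simvar z) / (T - z.1))).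
Proof.
move=> zT r0; rewrite /visc_flux mulrDr; congr (_ + _); first by ring.
have r1 : enorm z.2 != 0 by rewrite gt_eqF.
have s1 : Num.sqrt (T - z.1) != 0 by rewrite gt_eqF// sqrtr_gt0 subr_gt0.
rewrite (_ : \sum_j _ = vel u i z * (derive1 U (simvar z) / (T - z.1))); first by ring.
pose b := U (simvar z) / (Num.sqrt (T - z.1) * enorm z.2).
pose c := derive1 U (simvar z) / (T - z.1) - b.
have vE k : vel u k z = b * z.2 0 k.
  by rewrite velE /b; field; rewrite r1 s1.
transitivity (\sum_j (z.2 0 i / enorm z.2 ^+ 2 * c * b * z.2 0 j ^+ 2
    + (b ^+ 2 * z.2 0 i) * (delta_mx 0 i : 'rV[R]_d) 0 j)).
  apply: eq_bigr => j _; rewrite /Du !dx_velE// -/b -/c vE mxE eqxx/=.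
  rewrite [j == i]eq_sym; have [->|_] := eqVneq i j => /=; rewrite ?mulr1n ?mulr0n.
    by field.
  by field.
rewrite big_split/= -mulr_sumr -enorm_sqr sum_delta vE /c.
have T1 : T - z.1 != 0 by rewrite gt_eqF// subr_gt0.
by move: (b) => b'; field; rewrite r1 T1.
Qed.

Variables (t0 t1 N : R).
Hypotheses (t0_gt0 : 0 < t0) (t01 : t0 < t1) (t1T : t1 < T) (N0 : 0 < N).

(* [ss_u] vanishes at x = 0 (where it divides by [enorm x = 0]) whatever [U 0] is. *)
Definition energy_density (y : R) : R :=
  P y * ((if y == 0 then 0 else U y) ^+ 2 / 2 + CV * Th y).

(* Everything but the time derivative of the bump: the flux of the profile
   equation paired with the gradient and Laplacian of the cut-off. *)
Definition flux_density (y : R) : R :=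
  energy_density y * (y ^+ 2 / N ^+ 2 * deta (y ^+ 2 / N ^+ 2))
  + (U y * (energy_density y + P y * Rg * Th y)
     - ((2 * mu + lambda) * derive1 U y * U y + lambda * (d%:R - 1) * U y ^+ 2 / y))
    * (2 * y / N ^+ 2 * deta (y ^+ 2 / N ^+ 2))
  + kappa * Th y * ((4 * (y ^+ 2 / N ^+ 2) * ddeta (y ^+ 2 / N ^+ 2)
                     + 2 * d%:R * deta (y ^+ 2 / N ^+ 2)) / N ^+ 2).

(** Counting powers of T - t: the energy has weight -1, its flux and the viscous flux -3/2, theta
    -1. A space derivative of the cut-off adds -1/2 and the time derivative of its spatial factor
    adds -1. Every term except the one with the derivative of the bump thus has weight -2. *)
Lemma energy_integrandE z :
  energy CV rho u theta z * dt (cutoff T t0 t1 N) z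
  + \sum_j energy_flux CV Rg rho u theta j z * dx j (cutoff T t0 t1 N) z
  + kappa * (theta z * lap (cutoff T t0 t1 N) z)
  - \sum_j visc_flux mu lambda u j z * dx j (cutoff T t0 t1 N) z
  = dtime_bump t0 t1 z.1 / (T - z.1)
      * (energy_density (simvar z) * eta (simvar z ^+ 2 / N ^+ 2))
    + time_bump t0 t1 z.1 / (T - z.1) ^+ 2 * flux_density (simvar z).
Proof.
rewrite dt_cutoff// lap_cutoff//; under eq_bigr do rewrite dx_cutoff//.
under [X in _ - X]eq_bigr do rewrite dx_cutoff//.
have [Tz|zT] := leP T z.1.
  have [b0 b1] := @bump_out _ t0 t1 z.1 (or_intror (le_trans (ltW t1T) Tz)).
  rewrite b0 b1 !mul0r big1; last by move=> j _; rewrite mul0r mulr0.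
  rewrite big1; last by move=> j _; rewrite mul0r mulr0.
  by rewrite !mulr0; ring.
have T0 : 0 < T - z.1 by rewrite subr_gt0.
have s0 : 0 < Num.sqrt (T - z.1) by rewrite sqrtr_gt0.
have sE : Num.sqrt (T - z.1) ^+ 2 = T - z.1 by rewrite sqr_sqrtr// ltW.
have N1 : N != 0 by rewrite gt_eqF.
have s1 : Num.sqrt (T - z.1) != 0 by rewrite gt_eqF.
have T1 : T - z.1 != 0 by rewrite gt_eqF.
have simE : sim T N z = simvar z ^+ 2 / N ^+ 2.
  rewrite /sim /simvar; move: s1 sE; set s := Num.sqrt _ => s1 <-.
  by field; rewrite N1 s1.
rewrite simE; set w := simvar z ^+ 2 / N ^+ 2.
have rhoE : rho z = P (simvar z) by [].
have thE : theta z = Th (simvar z) / (T - z.1) by [].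
(* At x = 0 the velocity is 0 because [0^-1] is 0, and [deta], [ddeta] vanish at 0; only the term
   with the derivative of the bump survives. *)
have [z0|r1] := eqVneq (enorm z.2) 0.
  have y0 : simvar z = 0 by rewrite /simvar z0 mul0r.
  have w0 : w = 0 by rewrite /w y0 expr2 !mul0r.
  rewrite big1 => [|j _]; last by rewrite /energy_flux vel0// !mul0r.
  rewrite big1 => [|j _]; last first.
    rewrite /visc_flux vel0// mulr0 add0r big1 ?mulr0 ?mul0r// => k _.
    by rewrite vel0// mulr0.
  rewrite /flux_density -/w w0 deta_le1 ?ddeta_le1 ?ler01//.
  rewrite /energy big1 => [|j _]; last by rewrite vel0// expr2 mul0r.
  by rewrite rhoE thE /energy_density y0 eqxx invr0; ring.
have r0 : 0 < enorm z.2 by rewrite lt_neqAle eq_sym r1 enorm_ge0.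
have y1 : simvar z != 0 by rewrite mulf_neq0// invr_eq0.
pose b := U (simvar z) / (Num.sqrt (T - z.1) * enorm z.2).
have vE k : vel u k z = b * z.2 0 k.
  by rewrite velE /b; field; rewrite r1 s1.
have sum_sqr (F : 'I_d -> R) (k c : R) : (forall j, F j = k * z.2 0 j) ->
    \sum_j F j * (time_bump t0 t1 z.1 * (deta w * (2 * z.2 0 j / c)))
    = k * time_bump t0 t1 z.1 * deta w * 2 * enorm z.2 ^+ 2 / c.
  move=> Fk; rewrite enorm_sqr mulr_sumr mulr_suml; apply: eq_bigr => j _.
  by rewrite Fk; ring.
have eE : energy CV rho u theta z = energy_density (simvar z) / (T - z.1).
  rewrite /energy rhoE thE /energy_density (negbTE y1).
  under eq_bigr do rewrite vE exprMn.
  rewrite -mulr_sumr -enorm_sqr /b.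
  move: s1 sE; set s := Num.sqrt _ => s1' <-.
  by field; rewrite r1 s1'.
rewrite (sum_sqr _ (b * (energy_density (simvar z) / (T - z.1) + P (simvar z) * Rg * (Th (simvar z) / (T - z.1))))); last first.
  by move=> j; rewrite /energy_flux vE eE rhoE thE; ring.
rewrite (sum_sqr _ (b * (lambda * divu u z + 2 * mu * (derive1 U (simvar z) / (T - z.1))))); last first.
  by move=> j; rewrite visc_fluxE// vE; ring.
rewrite eE thE divuE// /flux_density -/w.
have rE : enorm z.2 = simvar z * Num.sqrt (T - z.1) by rewrite /simvar divfK.
rewrite /b rE.
move: s1 sE; set s := Num.sqrt _ => s1 sE; rewrite -sE.
have -> : w * deta w = simvar z ^+ 2 / N ^+ 2 * deta w by [].
move: (energy_density _) (deta w) (ddeta w) (eta w) => e e1 e2 e0.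
rewrite /w; clear w simE sum_sqr eE.
clear rE vE b; move: (simvar z) y1 s s1 sE => y y1 s s1 sE.
move: (derive1 U y) (dtime_bump _ _ _) (time_bump _ _ _) (U y) (P y) (Th y) => *.
by field; rewrite N1 s1 y1.
Qed.

End selfsimilar_fields.

(** * Separation of time and the similarity variable under the integral *)

Lemma integral_scale (R : realType) (d : nat) (c : R)
    (f : d.-tuple (measurableTypeR R) -> \bar R) : 0 < c ->
  (leb R d).-integrable setT f ->
  (\int[leb R d]_t f (scale_tuple c t) = (c ^- d)%:E * \int[leb R d]_t f t)%E.
Proof.
move=> c0 fi; have mf := measurable_int _ fi.
rewrite [LHS]integralE [in RHS]integralE.
rewrite muleBr//; last first.
  have := integrable_fin_num measurableT (integrable_funeneg measurableT fi).
  have := integrable_fin_num measurableT (integrable_funepos measurableT fi).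
  by move=> h1 h2; rewrite fin_num_adde_defr// fin_numN.
rewrite -(ge0_integral_scale c0 (measurable_funepos mf)); last by move=> t; exact: funepos_ge0.
rewrite -(ge0_integral_scale c0 (measurable_funeneg mf)); last by move=> t; exact: funeneg_ge0.
by congr (_ - _)%E; apply: eq_integral => t _; rewrite ?funeposE ?funenegE.
Qed.

Lemma integral_eq0_null (R : realType) (d : measure_display) (X : measurableType d)
    (mu : {measure set X -> \bar R}) (f : X -> \bar R) (D S : set X) :
  measurable D -> measurable_fun D f -> (forall x, D x -> 0 <= f x)%E ->
  (\int[mu]_(x in D) f x = 0)%E ->
  measurable S -> S `<=` D -> (forall x, S x -> f x != 0%E) -> mu S = 0%E.
Proof.
move=> mD mf f0 if0 mS SD Sf; apply: measure_negligible => //.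
have /(ae_eq_integral_abs _ mD mf) : (\int[mu]_(x in D) `|f x| = 0)%E.
  by rewrite -[RHS]if0; apply: eq_integral => x /[!inE] Dx; rewrite gee0_abs// f0.
by apply: negligibleS => x Sx /= /(_ (SD _ Sx)) /eqP; exact/negP/Sf.
Qed.

Section selfsimilar_integral.
Context {R : realType} {d : nat}.
Variables (T t0 t1 : R).
Hypotheses (t01 : t0 < t1) (t1T : t1 < T).
Local Notation mu := (@lebesgue_measure R).

Section amplitude.
Variable al : R -> R.
Hypothesis cal : forall t, t < T -> {for t, continuous al}.
Hypothesis al0 : forall t, t <= t0 \/ t1 <= t -> al t = 0.

(** Continuity is known only for t < T, so s = T - t reduces the claim to functions continuous on
    the positive half-line; for t >= T the amplitude is 0. *)
Lemma measurable_amplitude : measurable_fun setT (al : measurableTypeR R -> measurableTypeR R).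
Proof.
rewrite (_ : al = (fun s => if 0 < s then al (T - s) else al (T - 0)) \o (fun t => T - t)).
  apply: (@measurableT_comp _ _ _ _ _ _ _ _ (fun t : measurableTypeR R => T - t : measurableTypeR R)).
    apply: (@measurable_halfline _ (fun s => al (T - s))) => r r0.
    apply: (@continuous_comp _ _ _ (fun s => T - s) al).
      by apply: cvgB => //; exact: cvg_cst.
    by apply: cal; rewrite gtrBl.
  by apply: measurable_funB => //.
apply/funext => t /=; rewrite subr_gt0 subr0 subKr; case: ltP => // Tt.
by rewrite !al0//; right; rewrite ?(ltW t1T)// (le_trans (ltW t1T)).
Qed.

Lemma integrable_amplitude :
  mu.-integrable setT (fun t => (al t * Num.sqrt (T - t) ^+ d)%:E) /\
  \int[mu]_t (al t * Num.sqrt (T - t) ^+ d) =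
  \int[mu]_(t in `[t0, t1]) (al t * Num.sqrt (T - t) ^+ d).
Proof.
set b := fun t => al t * Num.sqrt (T - t) ^+ d.
have E : (EFin \o b) \_ `[t0, t1] = EFin \o b.
  apply/funext => t; rewrite patchE; case: ifPn => //.
  rewrite notin_setE/= in_itv/= => /negP; rewrite negb_and -!ltNge => h.
  rewrite /b al0 ?mul0r//.
  by case/orP : h => /ltW; [left|right].
split.
  suff : mu.-integrable `[t0, t1] (EFin \o b).
    move=> H; have := (@integrable_mkcond _ _ _ mu _ (EFin \o b) (measurable_itv `[t0, t1])).1 H.
    by rewrite E.
  apply: continuous_compact_integrable; first exact: segment_compact.
  apply: continuous_in_subspaceT => t; rewrite inE/= in_itv/= => /andP[_ tt1].
  have tT : t < T by exact: le_lt_trans t1T.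
  apply: cvgM; first exact: cal.
  apply: (@continuous_comp _ _ _ (fun t => Num.sqrt (T - t)) (fun x => x ^+ d)); last exact: exprn_continuous.
  apply: (@continuous_comp _ _ _ (fun t => T - t) Num.sqrt); last exact: sqrt_continuous.
  by apply: cvgB => //; exact: cvg_cst.
by rewrite [in RHS]/Rintegral integral_mkcond E.
Qed.

Variable k : R -> R.
Hypothesis ck : forall r, 0 < r -> {for r, continuous k}.
Hypothesis ik : (leb R d).-integrable setT (fun t => (k (radius t))%:E).

Let G (z : measurableTypeR R * d.-tuple (measurableTypeR R)) : R :=
  al z.1 * k (radius z.2 / Num.sqrt (T - z.1)).

Let measurable_G : measurable_fun setT (fun z => (G z)%:E).
Proof.
apply/measurable_EFinP; apply: measurable_funM.
  by apply: (measurableT_comp measurable_amplitude).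
have mr : measurable_fun setT (fun z : measurableTypeR R * d.-tuple (measurableTypeR R) =>
    radius z.2 : measurableTypeR R).
  exact: (measurableT_comp (@measurable_radius R d) measurable_snd).
have mT : measurable_fun setT (fun z : measurableTypeR R * d.-tuple (measurableTypeR R) =>
    T - z.1 : measurableTypeR R) by exact: measurable_funB.
have ms : measurable_fun setT (fun z : measurableTypeR R * d.-tuple (measurableTypeR R) =>
    Num.sqrt (T - z.1) : measurableTypeR R).
  exact: (measurableT_comp (continuous_measurable_fun (@sqrt_continuous R)) mT).
have mi : measurable_fun setT (fun z : measurableTypeR R * d.-tuple (measurableTypeR R) =>
    (Num.sqrt (T - z.1))^-1 : measurableTypeR R).
  apply: (measurable_comp_ge0 (f := GRing.inv) _ ms) => [r r0|z]; last exact: sqrtr_ge0.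
  by apply: inv_continuous; rewrite gt_eqF.
apply: (measurable_comp_ge0 ck (measurable_funM mr mi)) => z.
by rewrite mulr_ge0 ?radius_ge0// invr_ge0 sqrtr_ge0.
Qed.

Let slice (t : R) (x : d.-tuple (measurableTypeR R)) : t < T ->
  k (radius x / Num.sqrt (T - t)) = k (radius (scale_tuple (Num.sqrt (T - t))^-1 x)).
Proof. by move=> tT; rewrite radius_scale ?invr_ge0 ?sqrtr_ge0// mulrC. Qed.

Let alT t : T <= t -> al t = 0.
Proof. by move=> Tt; rewrite al0//; right; exact: le_trans (ltW t1T) Tt. Qed.

(** On each slice t < T the dilation x |-> x / sqrt (T - t) has Jacobian (T - t)^(-d/2), which
    leaves a function of t times an integral independent of t; Tonelli concludes. *)
Lemma integrable_selfsimilar :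
  (mu \x leb R d)%E.-integrable setT (fun z => (G z)%:E).
Proof.
apply/integrable12ltyP; first exact: measurable_G.
have mk := measurable_int _ ik.
have [bi _] := integrable_amplitude.
set I := (\int[leb R d]_t `|(k (radius t))%:E|)%E.
have Ioo : (I < +oo)%E by case/integrableP : ik.
have I0 : (0 <= I)%E by exact: integral_ge0.
have -> : (\int[mu]_t \int[leb R d]_y `|(G (t, y))%:E| =
    \int[mu]_t (`|(al t * Num.sqrt (T - t) ^+ d)%:E| * I))%E.
  apply: eq_integral => t _; have [Tt|tT] := leP T t.
    rewrite alT// mul0r /= normr0 mul0e; apply: integral0_eq => x _.
    by rewrite /G/= alT// mul0r normr0.
  have s0 : 0 < Num.sqrt (T - t) by rewrite sqrtr_gt0 subr_gt0.
  under eq_integral do rewrite /G/= (slice _ tT).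
  rewrite (@ge0_integral_scale R d _ (fun x => `|(al t * k (radius x))%:E|%E)); last 3 first.
  - by rewrite invr_gt0.
  - apply: measurableT_comp => //; apply/measurable_EFinP; apply: measurable_funM => //.
    exact/measurable_EFinP.
  - by move=> x; exact: abse_ge0.
  rewrite exprVn invrK.
  under eq_integral do rewrite EFinM abseM.
  rewrite ge0_integralZl//; last exact: measurableT_comp.
  rewrite muleA -/I /= -EFinM; congr (_%:E * _)%E.
  by rewrite normrM (ger0_norm (exprn_ge0 _ (ltW s0))) mulrC.
rewrite ge0_integralZr//; last by apply: measurableT_comp => //; exact: measurable_int bi.
have boo : (\int[mu]_t `|(al t * Num.sqrt (T - t) ^+ d)%:E| < +oo)%E by case/integrableP : bi.
have b0 : (0 <= \int[mu]_t `|(al t * Num.sqrt (T - t) ^+ d)%:E|)%E by exact: integral_ge0.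
by apply: lte_mul_pinfty; rewrite ?ge0_fin_numE.
Qed.

Lemma integral_selfsimilar :
  (\int[mu \x leb R d]_z (G z)%:E =
   (\int[mu]_(t in `[t0, t1]) (al t * Num.sqrt (T - t) ^+ d)
    * \int[leb R d]_x k (radius x))%:E)%E.
Proof.
have [bi bE] := integrable_amplitude.
rewrite -integral12_prod_meas1; last exact: integrable_selfsimilar.
rewrite -bE EFinM.
set I := \int[leb R d]_x k (radius x).
have IE : (\int[leb R d]_x (k (radius x))%:E)%E = I%:E.
  by rewrite fineK// integrable_fin_num.
transitivity (\int[mu]_t ((al t * Num.sqrt (T - t) ^+ d)%:E * I%:E))%E.
  apply: eq_integral => t _; rewrite /fubini_F; have [Tt|tT] := leP T t.
    rewrite alT// mul0r mul0e; apply: integral0_eq => x _.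
    by rewrite /G/= alT// mul0r.
  have s0 : 0 < Num.sqrt (T - t) by rewrite sqrtr_gt0 subr_gt0.
  under eq_integral do rewrite /G/= (slice _ tT) EFinM.
  rewrite (@integral_scale R d _ (fun x => (al t)%:E * (k (radius x))%:E)%E); last 2 first.
  - by rewrite invr_gt0.
  - exact: integrableZl.
  by rewrite exprVn invrK integralZl// IE muleA -!EFinM [in RHS]mulrC; congr EFin; ring.
rewrite integralZr//; congr (_ * _)%E.
by rewrite /Rintegral fineK// integrable_fin_num.
Qed.

End amplitude.
End selfsimilar_integral.

(** * Integration by parts in time *)

Section time_balance.
Context {R : realType} {d : nat}.
Variables (T t0 t1 : R).
Hypotheses (t01 : t0 < t1) (t1T : t1 < T).
Local Notation mu := (@lebesgue_measure R).

Definition amp_dt (t : R) : R := dtime_bump t0 t1 t / (T - t).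
Definition amp (t : R) : R := time_bump t0 t1 t / (T - t) ^+ 2.

Lemma continuous_amp_dt t : t < T -> {for t, continuous amp_dt}.
Proof.
move=> tT; apply: cvgM; first exact: continuous_dbump.
apply: (@continuous_comp _ _ _ (fun t => T - t) GRing.inv).
  by apply: cvgB => //; exact: cvg_cst.
by apply: inv_continuous; rewrite gt_eqF// subr_gt0.
Qed.

Lemma continuous_amp t : t < T -> {for t, continuous amp}.
Proof.
move=> tT; apply: cvgM; first exact: continuous_bump.
apply: (@continuous_comp _ _ _ (fun t => (T - t) ^+ 2) GRing.inv).
  apply: (@continuous_comp _ _ _ (fun t => T - t) (fun x => x ^+ 2)); last exact: exprn_continuous.
  by apply: cvgB => //; exact: cvg_cst.
by apply: inv_continuous; rewrite expf_neq0// gt_eqF// subr_gt0.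
Qed.

Lemma amp_dt0 t : t <= t0 \/ t1 <= t -> amp_dt t = 0.
Proof. by move=> /(@bump_out _ t0 t1)[_ e]; rewrite /amp_dt e mul0r. Qed.

Lemma amp0 t : t <= t0 \/ t1 <= t -> amp t = 0.
Proof. by move=> /(@bump_out _ t0 t1)[e _]; rewrite /amp e mul0r. Qed.

Lemma amp_gt0 t : t0 < t < t1 -> 0 < amp t.
Proof.
move=> tt; rewrite divr_gt0 ?bump_gt0// exprn_gt0// subr_gt0.
by case/andP : tt => _ /lt_trans; apply.
Qed.

Let is_derive_amp_sqrt t : t < T ->
  is_derive t 1 (fun t => time_bump t0 t1 t * (Num.sqrt (T - t) ^+ d / (T - t)))
    (amp_dt t * Num.sqrt (T - t) ^+ d
     + (1 - d%:R / 2) * (amp t * Num.sqrt (T - t) ^+ d)).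
Proof.
move=> tT; have T0 : 0 < T - t by rewrite subr_gt0.
have T1 : T - t != 0 by rewrite gt_eqF.
have s0 : 0 < Num.sqrt (T - t) by rewrite sqrtr_gt0.
have s1 : Num.sqrt (T - t) != 0 by rewrite gt_eqF.
have dT : is_derive t 1 (fun y : R => T - y) (-1).
  by apply: (is_derive_eq (is_derive_sub (is_derive_const T t 1) (is_derive_id t (1 : R)))); rewrite sub0r.
have ds := is_derive_chain (f := fun y : R => T - y) (is_derive1_sqrt T0) dT.
have dV := is_derive_inv (f := fun y : R => T - y) T1 dT.
apply: (is_derive_eq (is_derive_mul (is_derive_bump t0 t1 t) (is_derive_mul (is_derive_pow d ds) dV))).
rewrite /amp_dt /amp.
have sE : Num.sqrt (T - t) ^+ 2 = T - t by rewrite sqr_sqrtr// ltW.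
move: s1 sE; set s := Num.sqrt _ => s1 <-.
move: (time_bump _ _ _) (dtime_bump _ _ _) => a a'.
(* For d = 0 the predecessor [d.-1] is truncated and s^d cannot be split as s times s^(d-1). *)
have [->|dn] := eqVneq d 0%N; first by rewrite !expr0; field.
have -> : s ^+ d = s * s ^+ d.-1 by rewrite -exprS prednK// lt0n.
by field.
Qed.

(** The derivative of a(t) (T - t)^(d/2 - 1) integrates to 0 because the bump a vanishes at t0 and
    t1; the exponent comes out as the factor. *)
Lemma amp_balance :
  \int[mu]_(t in `[t0, t1]) (amp_dt t * Num.sqrt (T - t) ^+ d) =
  (d%:R / 2 - 1) * \int[mu]_(t in `[t0, t1]) (amp t * Num.sqrt (T - t) ^+ d).
Proof.
have [i1 e1] := @integrable_amplitude R d T t0 t1 t1T _ continuous_amp_dt amp_dt0.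
have [i2 e2] := @integrable_amplitude R d T t0 t1 t1T _ continuous_amp amp0.
have j1 : mu.-integrable `[t0, t1] (EFin \o (fun t => amp_dt t * Num.sqrt (T - t) ^+ d)).
  by apply: integrableS i1.
have j2 : mu.-integrable `[t0, t1] (EFin \o (fun t => amp t * Num.sqrt (T - t) ^+ d)).
  by apply: integrableS i2.
suff : \int[mu]_(t in `[t0, t1]) (amp_dt t * Num.sqrt (T - t) ^+ d
     + (1 - d%:R / 2) * (amp t * Num.sqrt (T - t) ^+ d)) = 0.
  rewrite RintegralD//; last by apply: (integrableZl _ _ j2).
  rewrite RintegralZl// => /eqP; rewrite addr_eq0 => /eqP ->; ring.
pose F t := time_bump t0 t1 t * (Num.sqrt (T - t) ^+ d / (T - t)).
have cs t : t < T -> {for t, continuous (fun t => Num.sqrt (T - t) ^+ d)}.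
  move=> tT; apply: (@continuous_comp _ _ _ (fun t => Num.sqrt (T - t)) (fun x => x ^+ d)); last exact: exprn_continuous.
  apply: (@continuous_comp _ _ _ (fun t => T - t) Num.sqrt); last exact: sqrt_continuous.
  by apply: cvgB => //; exact: cvg_cst.
rewrite /Rintegral (@continuous_FTC2 _ _ F)//.
- by rewrite /F !(@bump_out _ t0 t1 _ _).1 ?mul0r ?subee//; [left|right].
- apply: continuous_in_subspaceT => t; rewrite inE/= in_itv/= => /andP[_ tt1].
  have tT : t < T by exact: le_lt_trans t1T.
  apply: cvgD; first by apply: cvgM; [exact: continuous_amp_dt|exact: cs].
  apply: cvgM; first exact: cvg_cst.
  by apply: cvgM; [exact: continuous_amp|exact: cs].
- split.
  + move=> t; rewrite in_itv/= => /andP[_ tt1].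
    by have [] := is_derive_amp_sqrt (lt_trans tt1 t1T).
  + apply: cvg_at_right_filter; apply: is_derive_continuous (is_derive_amp_sqrt _).
    exact: lt_trans t1T.
  + by apply: cvg_at_left_filter; apply: is_derive_continuous (is_derive_amp_sqrt _).
- move=> t; rewrite in_itv/= => /andP[_ tt1]; rewrite derive1E; apply: derive_val.
  by apply: is_derive_amp_sqrt; exact: lt_trans t1T.
Qed.

(** This is the time factor common to both terms of the weak identity; its positivity allows it to
    be divided out. *)
Lemma amp_integral_gt0 :
  0 < \int[mu]_(t in `[t0, t1]) (amp t * Num.sqrt (T - t) ^+ d).
Proof.
have [i2 e2] := @integrable_amplitude R d T t0 t1 t1T _ continuous_amp amp0.
have b0 t : 0 <= amp t * Num.sqrt (T - t) ^+ d.
  by rewrite mulr_ge0 ?exprn_ge0 ?sqrtr_ge0// mulr_ge0 ?bump_ge0// invr_ge0 sqr_ge0.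
rewrite -e2 lt_neqAle Rintegral_ge0// andbT; apply/negP => /eqP/esym J0.
have J0' : (\int[mu]_t (amp t * Num.sqrt (T - t) ^+ d)%:E = 0)%E.
  by rewrite -[RHS]/(0%:E) -J0 fineK// integrable_fin_num.
have mI : mu `]t0, t1[%classic = (t1 - t0)%:E.
  by rewrite [LHS]lebesgue_measure_itv/= lte_fin t01 -EFinB.
have : mu `]t0, t1[%classic = 0%E.
  apply: (@integral_eq0_null R _ _ mu _ _ `]t0, t1[%classic measurableT (measurable_int _ i2) _ J0' (measurable_itv _)) => // t.
    by rewrite lee_fin.
  rewrite /= in_itv/= => tt.
  rewrite eqe mulf_neq0// ?gt_eqF ?amp_gt0// exprn_gt0// sqrtr_gt0 subr_gt0.
  by case/andP : tt => _ /lt_trans; apply.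
by rewrite mI => -[] /eqP; rewrite subr_eq0 gt_eqF.
Qed.

End time_balance.

(** * The weak energy identity for the profile *)

Section profile_identity.
Context {R : realType} {d : nat}.
Variables (CV Rg kappa mu lambda T : R) (P U Th : R -> R).
Hypothesis T_gt0 : 0 < T.
Hypothesis dU : forall r : R, 0 < r -> derivable U r 1.
Hypothesis weak : cNS_distr CV Rg kappa mu lambda
  (ss_rho T P : R * 'rV[R]_d -> R) (ss_u T U) (ss_theta T Th)
  [set z | 0 < z.1 < T].
Variable N : R.
Hypothesis N0 : 0 < N.

Let A (y : R) : R := energy_density CV P U Th y * eta (y ^+ 2 / N ^+ 2).
Let K (y : R) : R := @flux_density R d CV Rg kappa mu lambda P U Th N y.

Lemma profile_energy_weak :
  (forall r, 0 < r -> {for r, continuous A}) ->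
  (forall r, 0 < r -> {for r, continuous K}) ->
  (leb R d).-integrable setT (fun t => (A (radius t))%:E) ->
  (leb R d).-integrable setT (fun t => (K (radius t))%:E) ->
  (d%:R / 2 - 1) * \int[leb R d]_t A (radius t) + \int[leb R d]_t K (radius t) = 0.
Proof.
move=> cA cK iA iK.
(* Any 0 < t0 < t1 < T would do. *)
pose t0 := T / 4; pose t1 := T / 2.
have t00 : 0 < t0 by rewrite divr_gt0.
have t01 : t0 < t1 by rewrite ltr_pM2l// ltf_pV2 ?posrE// ltr_nat.
have t1T : t1 < T by rewrite ltr_pdivrMr// ltr_pMr// ltr1n.
have [_ _ _ /(_ (cutoff T t0 t1 N) (test_fun_cutoff t00 t01 t1T N0))] := weak.
have a1 := @continuous_amp_dt R T t0 t1.
have a10 := @amp_dt0 R T t0 t1.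
have a2 := @continuous_amp R T t0 t1.
have a20 := @amp0 R T t0 t1.
rewrite (_ : (\int[_]_z _)%E = (\int[@lebesgue_measure R \x leb R d]_z
   ((amp_dt T t0 t1 z.1 * A (radius z.2 / Num.sqrt (T - z.1)))%:E
    + (amp T t0 t1 z.1 * K (radius z.2 / Num.sqrt (T - z.1)))%:E))%E); last first.
  by apply: eq_integral => z _; rewrite energy_integrandE.
rewrite integralD//.
- rewrite (integral_selfsimilar t1T a1 a10 cA iA) (integral_selfsimilar t1T a2 a20 cK iK).
  rewrite -EFinD (amp_balance t01 t1T) => -[].
  have := @amp_integral_gt0 R d T t0 t1 t01 t1T.
  move: (\int[lebesgue_measure]_(t in _) _) => J J0 JE.
  apply/eqP; rewrite -(mulrI_eq0 _ (mulfI (lt0r_neq0 J0))); apply/eqP; rewrite -JE; ring.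
- exact: (integrable_selfsimilar t1T a1 a10 cA iA).
- exact: (integrable_selfsimilar t1T a2 a20 cK iK).
Qed.

End profile_identity.

(** * The limit N -> oo *)

Section continuity_rules.
Context {R : realType}.
Implicit Types (f g : R -> R) (r : R).

Lemma cont_add f g r : continuous_at r f -> continuous_at r g ->
  continuous_at r (fun x => f x + g x).
Proof. by move=> cf cg; exact: cvgD. Qed.

Lemma cont_opp f r : continuous_at r f -> continuous_at r (fun x => - f x).
Proof. by move=> cf; exact: cvgN. Qed.

Lemma cont_mul f g r : continuous_at r f -> continuous_at r g ->
  continuous_at r (fun x => f x * g x).
Proof. by move=> cf cg; exact: cvgM. Qed.

Lemma cont_comp f g r : continuous_at r f -> continuous_at (f r) g ->
  continuous_at r (fun x => g (f x)).
Proof. by move=> cf cg; exact: continuous_comp. Qed.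

Lemma cont_pow f n r : continuous_at r f -> continuous_at r (fun x => f x ^+ n).
Proof. by move=> cf; apply: (cont_comp (g := fun x => x ^+ n)) => //; exact: exprn_continuous. Qed.

Lemma cont_norm f r : continuous_at r f -> continuous_at r (fun x => `|f x|).
Proof. by move=> cf; exact: cvg_norm. Qed.

Lemma cont_inv f r : f r != 0 -> continuous_at r f -> continuous_at r (fun x => (f x)^-1).
Proof. by move=> f0 cf; exact: cvgV. Qed.

Lemma cont_flat n f r : continuous_at r f -> continuous_at r (fun x => flat n (f x)).
Proof.
by move=> cf; apply: cont_comp => //; exact: is_derive_continuous (is_derive_flat n (f r)).
Qed.

Lemma cont_eta f r : continuous_at r f -> continuous_at r (fun x => eta (f x)).
Proof.
by move=> cf; apply: cont_comp => //; exact: is_derive_continuous (is_derive_eta (f r)).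
Qed.

Lemma cont_deta f r : continuous_at r f -> continuous_at r (fun x => deta (f x)).
Proof.
by move=> cf; apply: cont_comp => //; exact: is_derive_continuous (is_derive_deta (f r)).
Qed.

End continuity_rules.

Ltac cont_step := lazymatch goal with
  | |- continuous_at _ (fun x => x) => exact: cvg_id
  | |- continuous_at _ (fun _ => ?c) => exact: cvg_cst
  | |- continuous_at _ (fun x => @?f x + @?g x) => apply: (@cont_add _ f g)
  | |- continuous_at _ (fun x => @?f x * @?g x) => apply: (@cont_mul _ f g)
  | |- continuous_at _ (fun x => - @?f x) => apply: (@cont_opp _ f)
  | |- continuous_at _ (fun x => @?f x ^+ ?n) => apply: (@cont_pow _ f n)
  | |- continuous_at _ (fun x => `| @?f x |) => apply: (@cont_norm _ f)
  | |- continuous_at _ (fun x => (@?f x)^-1) => apply: (@cont_inv _ f)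
  | |- continuous_at _ (fun x => flat ?n (@?f x)) => apply: (@cont_flat _ n f)
  | |- continuous_at _ (fun x => eta (@?f x)) => apply: (@cont_eta _ f)
  | |- continuous_at _ (fun x => deta (@?f x)) => apply: (@cont_deta _ f)
  end.

Ltac cont :=
  refine (_ : continuous_at _ _); repeat (cbv beta; cont_step); try assumption.

Lemma cont_ddeta (R : realType) (f : R -> R) (r : R) :
  continuous_at r f -> continuous_at r (fun x => ddeta (f x)).
Proof. by move=> cf; apply: cont_comp => //; rewrite /ddeta /dflat; cont. Qed.

Lemma cont_near (R : realType) (f g : R -> R) (r : R) :
  (\near r, f r = g r) -> continuous_at r f -> continuous_at r g.
Proof.
move=> fg cf; have : f y @[y --> r] --> g r by rewrite -(nbhs_singleton fg); exact: cf.
by apply: cvg_trans; exact: near_eq_cvg.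
Qed.

Section vanishing_energy.
Context {R : realType} {d : nat}.
Variables (CV Rg kappa mu lambda T : R) (P U Th : R -> R).
Hypothesis T_gt0 : 0 < T.
Hypothesis CV_gt0 : 0 < CV.
Hypothesis d_neq2 : d%:R / 2 - 1 != 0 :> R.
Hypothesis P_ge0 : forall r, 0 < r -> 0 <= P r.
Hypothesis Th_ge0 : forall r, 0 < r -> 0 <= Th r.
Hypothesis dP : forall r : R, 0 < r -> derivable P r 1.
Hypothesis dU : forall r : R, 0 < r -> derivable U r 1.
Hypothesis dTh : forall r : R, 0 < r -> derivable Th r 1.
Hypothesis ddU : forall r : R, 0 < r -> derivable (derive1 U) r 1.
Hypothesis weak : cNS_distr CV Rg kappa mu lambda
  (ss_rho T P : R * 'rV[R]_d -> R) (ss_u T U) (ss_theta T Th)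
  [set z | 0 < z.1 < T].

Let int (f : R -> R) := (leb R d).-integrable setT (fun t => (f (radius t))%:E).

Hypothesis iTh : int Th.
Hypothesis iPTh : int (fun r => P r * Th r).
Hypothesis iPThU : int (fun r => P r * Th r * U r).
Hypothesis iPU2 : int (fun r => P r * U r ^+ 2).
Hypothesis iU2 : int (fun r => U r ^+ 2).
Hypothesis PU3 : (fun eps : R => (eps%:E *
      \int[leb R d]_(t in [set t | (radius t <= eps^-1)%R])
        (P (radius t) * `|U (radius t)| ^+ 3)%R%:E)%E)
    @ 0^'+ --> (0%E : \bar R).

Let cP r : 0 < r -> {for r, continuous P}.
Proof. by move=> /dP /derivable_derive1 /is_derive_continuous. Qed.

Let cU r : 0 < r -> {for r, continuous U}.
Proof. by move=> /dU /derivable_derive1 /is_derive_continuous. Qed.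

Let cTh r : 0 < r -> {for r, continuous Th}.
Proof. by move=> /dTh /derivable_derive1 /is_derive_continuous. Qed.

Let cdU r : 0 < r -> {for r, continuous (derive1 U)}.
Proof. by move=> /ddU /derivable_derive1 /is_derive_continuous. Qed.

Let A : R -> R := energy_density CV P U Th.

Let AE r : 0 < r -> A r = P r * (U r ^+ 2 / 2 + CV * Th r).
Proof. by move=> r0; rewrite /A /energy_density gt_eqF. Qed.

Let cA r : 0 < r -> {for r, continuous A}.
Proof.
move=> r0; apply: (@cont_near _ (fun r => P r * (U r ^+ 2 / 2 + CV * Th r))).
  by apply: filterS (lt_nbhsr r0) => y /AE ->.
have := cP r0; have := cU r0; have := cTh r0 => cTr cUr cPr; cont.
Qed.

Let intZ (c : R) f : int f -> int (fun r => c * f r).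
Proof. exact: integrableZl. Qed.

Let intD f g : int f -> int g -> int (fun r => f r + g r).
Proof. exact: integrableD. Qed.

Let int_norm f : int f -> int (fun r => `|f r|).
Proof. by move/integrable_abse. Qed.

Let int_le (f g : R -> R) : (forall r, 0 < r -> {for r, continuous f}) ->
  (forall r, 0 <= r -> `|f r| <= `|g r|) -> int g -> int f.
Proof.
move=> cf fg; apply: le_integrable => //.
  by apply/measurable_EFinP; exact: measurable_fun_radial.
by move=> t _; rewrite /= lee_fin fg// radius_ge0.
Qed.

(** The bound also holds at 0, where [energy_density] replaces the velocity by 0 and so only loses a
    nonnegative amount in absolute value. *)
Let iA : int A.
Proof.
apply: (@int_le _ (fun r => 1/2 * `|P r * U r ^+ 2| + CV * `|P r * Th r|)).
- exact: cA.
- move=> r r0; apply: le_trans (ler_norm _); rewrite /A /energy_density normrM.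
  set X := (if _ then _ else _).
  have XU : `|X| <= `|U r| by rewrite /X; case: ifP => // _; rewrite normr0.
  apply: (@le_trans _ _ (`|P r| * (`|U r| ^+ 2 / 2 + CV * `|Th r|))); last first.
    by rewrite [`|P r * Th r|]normrM [`|P r * _|]normrM normrX; lra.
  rewrite ler_wpM2l//; apply: (le_trans (ler_normD _ _)).
  rewrite [`|X ^+ 2 / 2|]normrM normrX [`|CV * _|]normrM (gtr0_norm CV_gt0) lerD2r [`|2^-1|]ger0_norm ?invr_ge0//.
  by rewrite ler_wpM2r ?invr_ge0// lerXn2r// nnegrE.
- by apply: intD; apply: intZ; exact: int_norm.
Qed.


Let int_eq (f g : R -> R) : (forall r, 0 <= r -> f r = g r) -> int f -> int g.
Proof.
move=> fg; rewrite /int (_ : (fun t => _) = (fun t => (g (radius t))%:E))//.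
by apply/funext => t; rewrite fg// radius_ge0.
Qed.

Hypothesis d_gt0 : (0 < d)%N.

Let ir (f : R -> R) : R := \int[leb R d]_t f (radius t).

Let ir_eq (f g : R -> R) : (forall r, 0 <= r -> f r = g r) -> ir f = ir g.
Proof. by move=> fg; apply: eq_Rintegral => t _; rewrite fg// radius_ge0. Qed.

Let irD (f g : R -> R) : int f -> int g -> ir (fun r => f r + g r) = ir f + ir g.
Proof. by move=> fi gi; exact: RintegralD. Qed.

Let irZ (c : R) (f : R -> R) : int f -> ir (fun r => c * f r) = c * ir f.
Proof. by move=> fi; exact: RintegralZl. Qed.

Let ir_E (f : R -> R) : int f -> (ir f)%:E = (\int[leb R d]_t (f (radius t))%:E)%E.
Proof. by move=> fi; rewrite /ir /Rintegral fineK// integrable_fin_num. Qed.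

(** * The identity at a fixed cut-off scale N, with bounds uniform in N *)

Section cutoff_scale.
Variable N : R.
Hypothesis N1 : 1 <= N.

Let N0 : 0 < N. Proof. exact: lt_le_trans N1. Qed.
Let Nn0 : N != 0. Proof. by rewrite gt_eqF. Qed.

Let w (y : R) : R := y ^+ 2 / N ^+ 2.
(** The radial derivative of y |-> eta (w y); [dzeta] is its second derivative. *)
Let zeta (y : R) : R := 2 * y / N ^+ 2 * deta (w y).
Let dzeta (y : R) : R := (2 * deta (w y) + 4 * w y * ddeta (w y)) / N ^+ 2.
(** Up to a constant, the flux of the field zeta U^2 x / r through the sphere of radius y. Hence dh
    / y^(d-1) is a divergence that contains 2 zeta U U'. *)
Let h (y : R) : R := y ^+ d.-1 * (zeta y * U y ^+ 2).
Let dh (y : R) : R := d.-1%:R * y ^+ d.-1.-1 * (zeta y * U y ^+ 2)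
  + y ^+ d.-1 * (dzeta y * U y ^+ 2 + zeta y * (2 * U y * derive1 U y)).

Let w_le1 y : 0 <= y <= N -> w y <= 1.
Proof.
move=> /andP[y0 yN]; rewrite /w ler_pdivrMr ?exprn_gt0// mul1r.
by rewrite lerXn2r ?nnegrE// ltW.
Qed.

(** True from sqrt 2 * N on; the rounder 2 N later matches eps = 1/(2 N). *)
Let w_ge2 y : 2 * N <= y -> 2 <= w y.
Proof.
move=> Ny; rewrite /w ler_pdivlMr ?exprn_gt0//.
apply: (@le_trans _ _ ((2 * N) ^+ 2)).
  by rewrite exprMn ler_wpM2r ?sqr_ge0//; lra.
by rewrite lerXn2r ?nnegrE ?mulr_ge0 ?(ltW N0)// (le_trans _ Ny)// mulr_ge0 ?(ltW N0).
Qed.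

Let deta_out y : 0 <= y <= N \/ 2 * N <= y -> deta (w y) = 0.
Proof. by case=> [/w_le1/deta_le1|/w_ge2/deta_ge2]. Qed.

Let ddeta_out y : 0 <= y <= N \/ 2 * N <= y -> ddeta (w y) = 0.
Proof. by case=> [/w_le1/ddeta_le1|/w_ge2/ddeta_ge2]. Qed.

Let zeta_out y : 0 <= y <= N \/ 2 * N <= y -> zeta y = 0.
Proof. by move=> /deta_out e; rewrite /zeta e mulr0. Qed.

Let is_derive_zeta (y : R) : is_derive y 1 zeta (dzeta y).
Proof.
have dw : is_derive y 1 w (2 * y / N ^+ 2).
  rewrite /w; apply: (is_derive_eq (is_derive_mul (is_derive_pow 2 (is_derive_id y (1 : R))) (is_derive_const (N ^- 2) y 1))).
  by rewrite /=; ring.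
have d2 : is_derive y 1 (fun y : R => 2 * y / N ^+ 2) (2 / N ^+ 2).
  apply: (is_derive_eq (is_derive_mul (is_derive_cmul 2 (is_derive_id y (1 : R))) (is_derive_const (N ^- 2) y 1))).
  by rewrite /=; ring.
apply: (is_derive_eq (is_derive_mul d2 (is_derive_chain (f := w) (is_derive_deta (w y)) dw))).
rewrite /dzeta; have -> : 2 * y / N ^+ 2 * (ddeta (w y) * (2 * y / N ^+ 2)) = 4 * w y * ddeta (w y) / N ^+ 2.
  by rewrite /w; field.
by field.
Qed.

Let is_derive_h (y : R) : 0 < y -> is_derive y 1 h (dh y).
Proof.
move=> y0; have DU := derivable_derive1 (dU y0).
apply: (is_derive_eq (is_derive_mul (is_derive_pow d.-1 (is_derive_id y (1 : R)))
  (is_derive_mul (is_derive_zeta y) (is_derive_pow 2 DU)))).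
by rewrite /dh /= expr1 mulr1.
Qed.

Let cw y : continuous_at y w. Proof. by rewrite /w; cont. Qed.
Let cdeta y : continuous_at y (fun y => deta (w y)). Proof. exact: cont_deta. Qed.
Let cddeta y : continuous_at y (fun y => ddeta (w y)). Proof. exact: cont_ddeta. Qed.
Let czeta y : continuous_at y zeta.
Proof. by apply: cont_mul => //; cont. Qed.
Let cdzeta y : continuous_at y dzeta.
Proof.
have := @cdeta y; have := @cddeta y; have := @cw y => c1 c2 c3; rewrite /dzeta.
apply: cont_mul; last by cont.
apply: cont_add; first by apply: cont_mul => //; cont.
by apply: cont_mul => //; apply: cont_mul => //; cont.
Qed.

Let cdh (y : R) : 0 < y -> continuous_at y dh.
Proof.
move=> y0; have := cU y0; have := cdU y0; have := @czeta y; have := @cdzeta y.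
move=> c1 c2 c3 c4; rewrite /dh; cont.
Qed.

Let h_out y : 0 <= y <= N \/ 2 * N <= y -> h y = 0 /\ dh y = 0.
Proof.
move=> yo; rewrite /h /dh /dzeta zeta_out// deta_out// ddeta_out//.
by split; ring.
Qed.

Let NN : N < 2 * N. Proof. by rewrite ltr_pMl// ltr1n. Qed.

Let int_out (f : R -> R) : (forall r : R, 0 < r -> continuous_at r f) ->
  (forall r, 0 <= r <= N \/ 2 * N <= r -> f r = 0) -> int f.
Proof. by move=> cf f0; apply: (@integrable_radial_compact R d f N (2 * N)). Qed.

Let Dh (y : R) : R := dh y / y ^+ d.-1.

Let int_Dh : int Dh.
Proof.
apply: int_out => [r r0|r /h_out[_ e]]; last by rewrite /Dh e mul0r.
apply: cont_mul; first exact: cdh.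
by apply: cont_inv; [rewrite expf_neq0// gt_eqF|cont].
Qed.

Let ir_Dh : ir Dh = 0.
Proof. exact: (radial_integral_divergence N0 NN is_derive_h cdh h_out int_Dh). Qed.

(* The flux density with the cubic term removed and with
   [(2 mu + lambda) / 2 * Dh], whose integral is zero, added to eliminate U'. *)
Definition dominated_part (y : R) : R :=
  A y * ((d%:R / 2 - 1) * eta (w y) + w y * deta (w y))
  + (CV + Rg) * zeta y * (P y * Th y * U y)
  + kappa * ((4 * w y * ddeta (w y) + 2 * d%:R * deta (w y)) / N ^+ 2) * Th y
  + ((2 * mu + lambda) * (deta (w y) + 2 * w y * ddeta (w y))
     + (2 * mu - lambda) * (d%:R - 1) * deta (w y)) / N ^+ 2 * U y ^+ 2.

Definition cubic_part (y : R) : R := zeta y / 2 * (P y * U y ^+ 3).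

Let K : R -> R := @flux_density R d CV Rg kappa mu lambda P U Th N.

(** The viscous flux contributes - (2 mu + lambda) zeta U U', which is absorbed in the multiple of
    [Dh]; what remains of [Dh] contains only U^2. The energy flux splits into zeta P U^3 / 2 and (CV
    + Rg) zeta P Th U. The last term cancels the first integral of [profile_energy_weak]. *)
Let decomposition y : 0 <= y ->
  K y = dominated_part y + cubic_part y - (2 * mu + lambda) / 2 * Dh y
    - (d%:R / 2 - 1) * (A y * eta (w y)).
Proof.
rewrite le_eqVlt => /predU1P[<-|y0].
  have z0 : 0 <= (0 : R) <= N \/ 2 * N <= (0 : R) by left; rewrite lexx ltW.
  rewrite /K /flux_density /dominated_part /cubic_part /Dh (h_out z0).2 -/A -/(w 0).
  by rewrite (zeta_out z0) (deta_out z0) (ddeta_out z0); ring.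
have y1 : y != 0 by rewrite gt_eqF.
have -> : Dh y = (d%:R - 1) * zeta y / y * U y ^+ 2 + dzeta y * U y ^+ 2 + zeta y * (2 * U y * derive1 U y).
  rewrite /Dh /dh.
  have -> : d.-1%:R = d%:R - 1 :> R by rewrite -[in RHS](prednK d_gt0) -natr1 addrK.
  (* For d = 1 the exponent [d.-1.-1] is truncated, but its coefficient d - 1 is 0. *)
  have [d1|d1] := posnP d.-1.
    have -> : d%:R = 1 :> R by rewrite -(prednK d_gt0) d1.
    by rewrite d1 expr0; field.
  have -> : y ^+ d.-1 = y * y ^+ d.-1.-1 by rewrite -exprS prednK.
  have ? : y ^+ d.-1.-1 != 0 by rewrite expf_neq0.
  by field; apply/andP.
rewrite /K /flux_density /dominated_part /cubic_part -/A -/(w y) AE//.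
rewrite /zeta /dzeta.
move: (deta _) (ddeta _) (eta _) => e1 e2 e0.
have -> : w y = y ^+ 2 / N ^+ 2 by [].
by field; rewrite Nn0 y1.
Qed.

Variable C : R.
Hypothesis C0 : 0 < C.
Hypothesis etaC : forall s : R, [/\ `|eta s| <= C, `|deta s| <= C & `|ddeta s| <= C].

Let w_ge0 y : 0 <= w y. Proof. by rewrite divr_ge0// sqr_ge0. Qed.

Let wdeta_le y : `|w y * deta (w y)| <= 2 * C.
Proof.
have [w2|w2] := leP 2 (w y).
  by rewrite deta_ge2// mulr0 normr0 mulr_ge0// ltW.
by rewrite normrM ger0_norm//; apply: ler_pM => //; [exact: ltW|case: (etaC (w y))].
Qed.

Let wddeta_le y : `|w y * ddeta (w y)| <= 2 * C.
Proof.
have [w2|w2] := leP 2 (w y).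
  by rewrite ddeta_ge2// mulr0 normr0 mulr_ge0// ltW.
by rewrite normrM ger0_norm//; apply: ler_pM => //; [exact: ltW|case: (etaC (w y))].
Qed.

(** On the support y < 2 N the factor y costs one power of N; the remaining decay 1/N is what the
    cubic term lives on. *)
Let zeta_le y : 0 <= y -> `|zeta y| <= 4 * C / N.
Proof.
move=> y0; have [Ny|Ny] := leP (2 * N) y.
  by rewrite zeta_out ?normr0 ?divr_ge0 ?mulr_ge0 ?(ltW C0) ?(ltW N0)//; right.
have -> : 4 * C / N = (2 * (2 * N) / N ^+ 2) * C by field.
rewrite /zeta normrM; apply: ler_pM => //; last by case: (etaC (w y)).
rewrite ger0_norm; last by rewrite divr_ge0 ?sqr_ge0// mulr_ge0.
by rewrite ler_wpM2r ?invr_ge0 ?sqr_ge0// ler_wpM2l// ltW.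
Qed.

Let divN2_le x B : `|x| <= B -> `|x / N ^+ 2| <= B.
Proof.
move=> xB; rewrite normrM normfV [`|N ^+ 2|]ger0_norm ?sqr_ge0//.
rewrite ler_pdivrMr ?exprn_gt0//; apply: (le_trans xB).
by rewrite ler_peMr ?(le_trans _ xB)// exprn_ege1.
Qed.

(** A majorant independent of N >= 1. The factors 5 C = C + 4 C and 8 C come from |w ddeta(w)| <= 2
    C, since [ddeta] vanishes from 2 on. *)
Definition dominating (y : R) : R :=
  (`|d%:R / 2 - 1| * C + 2 * C) * `|A y|
  + `|CV + Rg| * (4 * C) * `|P y * Th y * U y|
  + `|kappa| * (8 * C + 2 * d%:R * C) * `|Th y|
  + (`|2 * mu + lambda| * (5 * C) + `|2 * mu - lambda| * `|d%:R - 1| * C) * `|U y ^+ 2|.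

Lemma dominated_part_le y : 0 <= y -> `|dominated_part y| <= dominating y.
Proof.
move=> y0; have [e0 e1 e2] := etaC (w y).
have h1 := wdeta_le y; have h2 := wddeta_le y.
rewrite /dominated_part /dominating.
apply: (le_trans (ler_normD _ _)); apply: lerD; last first.
  rewrite normrM; apply: ler_wpM2r => //.
  apply: divN2_le; apply: (le_trans (ler_normD _ _)); apply: lerD.
    rewrite normrM ler_wpM2l//; apply: (le_trans (ler_normD _ _)).
    by rewrite -[2 * w y * _]mulrA [`|2 * _|]normrM [`|2|]ger0_norm//; lra.
  by rewrite !normrM ler_wpM2l// mulr_ge0.
apply: (le_trans (ler_normD _ _)); apply: lerD; last first.
  rewrite normrM; apply: ler_wpM2r => //; rewrite normrM; apply: ler_wpM2l => //.
  apply: divN2_le; apply: (le_trans (ler_normD _ _)); apply: lerD.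
    by rewrite -mulrA normrM ger0_norm//; lra.
  by rewrite normrM ger0_norm ?mulr_ge0// ler_wpM2l ?mulr_ge0.
apply: (le_trans (ler_normD _ _)); apply: lerD; last first.
  rewrite normrM; apply: ler_wpM2r => //; rewrite normrM; apply: ler_wpM2l => //.
  by apply: (le_trans (zeta_le y0)); rewrite ler_pdivrMr// ler_peMr// mulr_ge0// ltW.
rewrite mulrC normrM; apply: ler_wpM2r => //; apply: (le_trans (ler_normD _ _)).
by apply: lerD => //; rewrite normrM ler_wpM2l.
Qed.

(** At a fixed radius the sequence in N is therefore eventually constant, which identifies its
    pointwise limit. *)
Lemma dominated_part_small y : 0 <= y <= N ->
  dominated_part y = (d%:R / 2 - 1) * eta 0 * A y.
Proof.
move=> yN; have yo : 0 <= y <= N \/ 2 * N <= y by left.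
rewrite /dominated_part (zeta_out yo) (deta_out yo) (ddeta_out yo).
by rewrite (eta_le1 (w_le1 yN)); ring.
Qed.

Lemma cubic_part_le y : 0 <= y ->
  `|cubic_part y| <= 4 * C * ((2 * N)^-1 * Num.max (P y * `|U y| ^+ 3) 0) /\
  (2 * N <= y -> cubic_part y = 0).
Proof.
move=> y0; split=> [|Ny]; last by rewrite /cubic_part zeta_out ?mul0r//; right.
have M0 : 0 <= Num.max (P y * `|U y| ^+ 3) 0 by rewrite le_max lexx orbT.
have [->|y1] := eqVneq y 0.
  rewrite /cubic_part zeta_out ?mul0r ?normr0; last by left; rewrite lexx ltW.
  rewrite mulr_ge0 ?mulr_ge0 ?(ltW C0)// ?invr_ge0 ?mulr_ge0 ?(ltW N0)//.
  by rewrite le_max lexx orbT.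
have y2 : 0 < y by rewrite lt_neqAle eq_sym y1.
rewrite /cubic_part [`|_ * (P y * _)|]normrM [`|_ / 2|]normrM [`|P y * _|]normrM normrX.
rewrite [`|2^-1|]ger0_norm ?invr_ge0// (ger0_norm (P_ge0 y2)) mulrA.
rewrite [X in _ <= X]mulrA -mulrA; apply: ler_pM => //; rewrite ?mulr_ge0 ?exprn_ge0 ?P_ge0//; last first.
  by rewrite le_max lexx.
apply: (@le_trans _ _ (4 * C / N / 2)); first by rewrite ler_wpM2r ?invr_ge0// zeta_le.
by rewrite invfM; lra.
Qed.

Lemma continuous_dominated_part (y : R) : 0 < y -> continuous_at y dominated_part.
Proof.
move=> y0; have := cA y0; have := cU y0; have := cP y0; have := cTh y0.
have := @czeta y; have := @cw y => c1 c2 c3 c4 c5 c6.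
by rewrite /dominated_part; cont.
Qed.

Lemma int_cubic_part : int cubic_part.
Proof.
apply: int_out => [r r0|r ro]; last by rewrite /cubic_part zeta_out ?mul0r.
have := cU r0; have := cP r0; have := @czeta r => c1 c2 c3.
by rewrite /cubic_part; cont; rewrite ?pnatr_eq0.
Qed.

Lemma int_dominating : int dominating.
Proof.
exact: (intD (intD (intD (intZ _ (int_norm iA)) (intZ _ (int_norm iPThU))) (intZ _ (int_norm iTh))) (intZ _ (int_norm iU2))).
Qed.

Lemma int_dominated_part : int dominated_part.
Proof.
apply: (int_le continuous_dominated_part _ int_dominating) => y y0.
exact: le_trans (dominated_part_le y0) (ler_norm _).
Qed.

Lemma dominated_balance : ir dominated_part = - ir cubic_part.
Proof.
have Aeta_c (y : R) : 0 < y -> continuous_at y (fun y => A y * eta (w y)).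
  by move=> y0; have := cA y0; have := @cw y => c1 c2; cont.
have Aeta_i : int (fun y => A y * eta (w y)).
  apply: (int_le Aeta_c _ (intZ C iA)) => y y0.
  rewrite !normrM [`|C|]ger0_norm ?(ltW C0)// mulrC ler_wpM2r//.
  by case: (etaC (w y)).
have idc := intD int_dominated_part int_cubic_part.
have iD := intZ (- ((2 * mu + lambda) / 2)) int_Dh.
have iE := intZ (- (d%:R / 2 - 1)) Aeta_i.
have iK : int K.
  apply: int_eq (intD (intD idc iD) iE) => y y0; rewrite decomposition//; ring.
have cK (y : R) : 0 < y -> continuous_at y K.
  move=> y0; have := cA y0; have := cU y0; have := cP y0; have := cTh y0; have := cdU y0.
  have := @cw y => c1 c2 c3 c4 c5 c6.
  by rewrite /K /flux_density; cont; rewrite ?gt_eqF ?exprn_gt0.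
have := profile_energy_weak T_gt0 dU weak N0 Aeta_c cK Aeta_i iK.
rewrite -/(ir K) -/(ir (fun y => A y * eta (w y))).
rewrite (@ir_eq K (fun y => dominated_part y + cubic_part y + - ((2 * mu + lambda) / 2) * Dh y
  + - (d%:R / 2 - 1) * (A y * eta (w y)))); last first.
  by move=> y y0; rewrite decomposition//; ring.
rewrite (irD (intD idc iD) iE) (irD idc iD) (irD int_dominated_part int_cubic_part).
rewrite (irZ _ int_Dh) (irZ _ Aeta_i) ir_Dh => H.
by apply/eqP; rewrite -addr_eq0 -H; apply/eqP; ring.
Qed.

End cutoff_scale.

(** The value of eps attached to the scale N = n + 1. *)
Let u (n : nat) : R := (2 * n.+1%:R)^-1.

Let u_cvg : u @ \oo --> 0^'+.
Proof.
move=> E /nbhs_ballP[e /= e0 eE].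
suff : \forall n \near \oo, E (u n) by [].
near=> n.
have un0 : 0 < u n by rewrite /u invr_gt0 mulr_gt0.
apply: eE => //.
rewrite /ball/= sub0r normrN ger0_norm ?invr_ge0 ?mulr_ge0//.
apply: (@le_lt_trans _ _ n.+1%:R^-1).
  by rewrite lef_pV2 ?posrE ?mulr_gt0// ler_pMl// ler1n.
by near: n; exact: near_infty_natSinv_lt (PosNum e0).
Unshelve. all: by end_near. Qed.

(** The integrals of P |U|^3 over balls may a priori be infinite, so the squeeze takes place in the
    extended reals. *)
Lemma cubic_part_cvg : ir (cubic_part n.+1%:R) @[n --> \oo] --> 0.
Proof.
have [C C0 etaC] := @eta_bounds R.
pose F (t : d.-tuple (measurableTypeR R)) := (P (radius t) * `|U (radius t)| ^+ 3)%:E.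
pose B (n : nat) := [set t : d.-tuple (measurableTypeR R) | radius t <= (u n)^-1].
have mB (c : R) : measurable [set t : d.-tuple (measurableTypeR R) | radius t <= c].
  apply: (@measurable_radius_preimage _ _ [set x | x <= c]).
  by rewrite -set_itvNyc; exact: measurable_itv.
have mF : measurable_fun setT F.
  apply/measurable_EFinP; apply: (@measurable_fun_radial R d (fun r => P r * `|U r| ^+ 3)) => r r0.
  by have := cU r0; have := cP r0 => c1 c2; cont.
(* The negative part of [F] can only charge the origin, a null set. *)
have FB n : (\int[leb R d]_(t in B n) F t = \int[leb R d]_(t in B n) F^\+ t)%E.
  rewrite [LHS]integralE [X in (_ - X)%E](_ : _ = 0%E) ?sube0//.
  rewrite (@ge0_negligible_integral _ _ _ (leb R d) (B n) [set t | radius t <= 0] _ (mB 0) (mB _)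
    (measurable_funTS (measurable_funeneg mF)) _ (leb_origin R d_gt0))//.
  apply: integral0_eq => t [_ /= /negP]; rewrite -ltNge => t0.
  by rewrite /F funenegE; apply/max_idPr; rewrite -EFinN lee_fin oppr_le0 mulr_ge0 ?P_ge0// exprn_ge0.
suff le_n n : (`|(ir (cubic_part n.+1%:R))%:E| <=
    (4 * C)%:E * ((u n)%:E * \int[leb R d]_(t in B n) F t))%E.
  have H0 : ((u n)%:E * \int[leb R d]_(t in B n) F t @[n --> \oo] --> 0)%E.
    by move=> W /PU3 /u_cvg.
  have H : ((4 * C)%:E * ((u n)%:E * \int[leb R d]_(t in B n) F t) @[n --> \oo] --> 0)%E.
    by rewrite -[X in _ --> X](mule0 (4 * C)%:E); apply: cvgeZl.
  have : (`|(ir (cubic_part n.+1%:R))%:E| @[n --> \oo] --> 0)%E.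
    by apply: squeeze_cvge (cvg_cst _) H; apply: nearW => n; rewrite abse_ge0 le_n.
  by move/cvg_abse0P/fine_cvg.
have N1 : 1 <= n.+1%:R :> R by rewrite ler1n.
have iq := int_cubic_part N1.
rewrite ir_E//.
apply: (le_trans (le_abse_integral _ _ _)) => //; first exact: measurable_int iq.
rewrite FB.
rewrite (_ : (\int[leb R d]_t _)%E = (\int[leb R d]_(t in B n) `|(cubic_part n.+1%:R (radius t))%:E|)%E); last first.
  rewrite [RHS]integral_mkcond; apply: eq_integral => t _; rewrite patchE.
  case: ifPn => //; rewrite notin_setE/= => /negP; rewrite -ltNge /u invrK => /ltW.
  by move=> /(cubic_part_le N1 C0 etaC (radius_ge0 t)).2 -> /=; rewrite normr0.
have u0 : (0 <= (u n)%:E)%E by rewrite lee_fin invr_ge0 mulr_ge0.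
have C4 : (0 <= (4 * C)%:E)%E by rewrite lee_fin mulr_ge0// ltW.
have mFp : measurable_fun (B n) (F^\+)%E by apply: measurable_funTS; exact: measurable_funepos.
rewrite -ge0_integralZl//; [|exact: mB].
rewrite -ge0_integralZl//; [|exact: mB|exact: emeasurable_funM|by move=> t _; rewrite mule_ge0].
apply: ge0_le_integral => //.
- exact: mB.
- apply: measurable_funTS; apply: measurableT_comp => //; exact: measurable_int iq.
- by apply: emeasurable_funM => //; apply: emeasurable_funM.
- move=> t _; rewrite funeposE /F /= -EFin_max -!EFinM lee_fin.
  exact: (cubic_part_le N1 C0 etaC (radius_ge0 t)).1.
Qed.

(** The same sequence has two limits: (d/2 - 1) eta(0) int A by dominated convergence, and 0 because
    it is the opposite of the cubic part. *)
Lemma energy_integral_eq0 : ir A = 0.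
Proof.
have [C C0 etaC] := @eta_bounds R.
have N1 n : 1 <= n.+1%:R :> R by rewrite ler1n.
pose c : R := (d%:R / 2 - 1) * eta 0.
have c0 : c != 0 by rewrite mulf_neq0// gt_eqF// eta0_gt0.
have domcvg : ((ir (dominated_part n.+1%:R))%:E @[n --> \oo] --> (c * ir A)%:E)%E.
  rewrite -irZ// ir_E; last exact: intZ.
  rewrite (_ : (fun n => _) = fun n => (\int[leb R d]_t (dominated_part n.+1%:R (radius t))%:E)%E); last first.
    by apply/funext => n; rewrite ir_E//; exact: (int_dominated_part (N1 n) C0 etaC).
  apply: (@dominated_cvg _ _ _ _ _ _ _ _ (fun t => (dominating C (radius t))%:E)) => //.
  - by move=> n; exact: measurable_int (int_dominated_part (N1 n) C0 etaC).
  - move=> t _; apply: cvg_near_cst; near=> n.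
    rewrite (dominated_part_small (N1 n))// radius_ge0/=.
    apply: (@le_trans _ _ n%:R); last by rewrite ler_nat.
    by near: n; exact: nbhs_infty_ger.
  - exact: int_dominating.
  - by move=> n t _; rewrite lee_fin; apply: dominated_part_le => //; exact: radius_ge0.
have h1 : ir (dominated_part n.+1%:R) @[n --> \oo] --> c * ir A.
  exact: (fine_cvg domcvg).
have h2 : ir (dominated_part n.+1%:R) @[n --> \oo] --> 0.
  rewrite (_ : (fun n => _) = fun n => - ir (cubic_part n.+1%:R)).
    by rewrite -oppr0; apply: cvgN; exact: cubic_part_cvg.
  by apply/funext => n; rewrite (dominated_balance (N1 n) C0 etaC).
have e : c * ir A = 0 by exact: (norm_cvg_unique h1 h2).
by move/eqP: e; rewrite mulf_eq0 (negbTE c0)/= => /eqP.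
Unshelve. all: by end_near. Qed.

(** [A] is nonnegative away from the origin with zero integral; if it were nonzero at r, continuity
    would make it nonzero on a shell, which has positive measure. *)
Lemma energy_eq0 r : 0 < r -> P r * (U r ^+ 2 / 2 + CV * Th r) = 0.
Proof.
move=> r0; rewrite -AE//; apply/eqP/negPn/negP => Ar.
have Age0 s : 0 < s -> 0 <= A s.
  move=> s0; rewrite AE// mulr_ge0 ?P_ge0// addr_ge0//.
    by rewrite divr_ge0 ?sqr_ge0.
  by rewrite mulr_ge0 ?Th_ge0// ltW.
have mB : measurable [set t : d.-tuple (measurableTypeR R) | radius t <= 0].
  apply: (@measurable_radius_preimage _ _ [set x | x <= 0]).
  by rewrite -set_itvNyc; exact: measurable_itv.
have I0 : (\int[leb R d]_(t in setT `\` [set t | (radius t <= 0)%R]) (A (radius t))%:E = 0)%E.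
  rewrite -negligible_integral//; last exact: leb_origin.
  rewrite -[LHS]fineK; last exact: integrable_fin_num.
  by rewrite -[fine _]/(ir A) energy_integral_eq0.
have /cvgr_neq0/(_ Ar) := cA r0.
move=> /nbhs_ballP[e /= e0 eA].
pose b := r + Num.min (e / 2) r.
have m0 : 0 < Num.min (e / 2) r by rewrite lt_min r0 divr_gt0.
have : leb R d [set t | r < radius t <= b] = 0%E.
  apply: (integral_eq0_null _ _ _ I0) => //.
  - exact: measurableD.
  - apply: measurable_funTS; exact: measurable_int iA.
  - by move=> t [_ /= /negP]; rewrite -ltNge lee_fin => /Age0.
  - exact: measurable_shell.
  - by move=> t /= /andP[rt _]; split => //; apply/negP; rewrite -ltNge (lt_trans r0).
  - move=> t /= /andP[rt tb]; rewrite eqe; apply: eA; rewrite /ball/= distrC.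
    rewrite ger0_norm ?subr_ge0 ?(ltW rt)// ltrBlDl (le_lt_trans tb)// ltrD2l.
    by rewrite gt_min ltr_pdivrMr// ltr_pMr// ltr1n.
have rb : r < b by rewrite ltrDl.
rewrite [LHS]leb_shell ?(ltW rb)// => -[] /eqP.
rewrite mulf_eq0 (gt_eqF (ball_vol_gt0 _ _))/= subr_eq0 gt_eqF//.
by rewrite ltrXn2r ?(ltW r0)// -lt0n.
Qed.

End vanishing_energy.

(** * The profiles when P = 0 *)

Section radial_growth.
Context {R : realType} {d : nat}.
Hypothesis d_gt0 : (0 < d)%N.
Variable f : R -> R.
Hypothesis fi : (leb R d).-integrable setT (fun t => (f (radius t))%:E).

(** Markov's inequality on a shell, with the volume of the unit ball absorbed in M. *)
Lemma integrable_shell_bound : exists2 M : R, 0 <= M &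
  forall a b m : R, 0 < a -> a <= b -> 0 <= m ->
    (forall x, a < x <= b -> m <= `|f x|) -> m * (b ^+ d - a ^+ d) <= M.
Proof.
have v0 := ball_vol_gt0 R d.
have fa := integrable_abse fi.
set I := \int[leb R d]_t `|f (radius t)|.
have IE : (\int[leb R d]_t `|(f (radius t))%:E| = I%:E)%E.
  by rewrite fineK// integrable_fin_num.
exists (I / ball_vol R d); first by rewrite divr_ge0 ?(ltW v0)// Rintegral_ge0.
move=> a b m a0 ab m0 fm; rewrite ler_pdivlMr//.
have mS := @measurable_shell R d a b.
have : (\int[leb R d]_(t in [set t | (a < radius t <= b)%R]) m%:E <= I%:E)%E.
  rewrite -IE; apply: (@le_trans _ _ (\int[leb R d]_(t in [set t | (a < radius t <= b)%R]) `|(f (radius t))%:E|))%E.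
    apply: ge0_le_integral => //.
    - apply: measurable_funTS; exact: measurable_int fa.
    - by move=> t /fm ?; rewrite /= lee_fin.
  apply: ge0_subset_integral => //; exact: measurable_int fa.
rewrite integral_cst// [X in (_ * X)%E](leb_shell d a0 ab) -EFinM lee_fin.
by apply: le_trans; rewrite le_eqVlt; apply/orP; left; apply/eqP; ring.
Qed.

Lemma integrable_not_bounded_below (m a : R) : 0 < m -> 0 < a ->
  ~ (forall x, a < x -> m <= `|f x|).
Proof.
move=> m0 a0 fm; have [M M0 HM] := integrable_shell_bound.
(* Since b >= 1, b^d >= b > a^d + M/m, against the shell bound. *)
pose b := a ^+ d + M / m + a + 1.
have ad : 0 < a ^+ d by rewrite exprn_gt0.
have Mm : 0 <= M / m by rewrite divr_ge0// ltW.
have b1 : 1 <= b by rewrite /b; lra.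
have ab : a <= b by rewrite /b; lra.
have fab x : a < x <= b -> m <= `|f x| by move=> /andP[/fm].
have := HM a b m a0 ab (ltW m0) fab; rewrite mulrC -ler_pdivlMr//.
have : b <= b ^+ d by apply: ler_eXnr.
by rewrite {1}/b; lra.
Qed.

End radial_growth.

Section radial_odes.
Context {R : realType} {d : nat}.
Hypothesis d1or3 : d = 1%N \/ (3 <= d)%N.
Variable f : R -> R.

Let d_gt0 : (0 < d)%N. Proof. by case: d1or3 => [->|/(leq_trans _)->]. Qed.

(** The term k r is excluded at infinity. The term b / r^(d-1) is a constant for d = 1, excluded at
    infinity too; for d >= 3 its square is too singular at the origin, with integral of order
    e^(2-d) over the shell e < r <= 2 e. *)
Lemma radial_linear_sqr_eq0 (k b : R) :
  (leb R d).-integrable setT (fun t => (f (radius t) ^+ 2)%:E) ->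
  (forall r, 0 < r -> f r = k * r + b / r ^+ d.-1) -> forall r, 0 < r -> f r = 0.
Proof.
move=> fi fE.
have k0 : k = 0.
  apply/eqP/negPn/negP => k0; have k1 : 0 < `|k| by rewrite normr_gt0.
  (* Beyond a, |k| x >= |k| + 2 |b| while the other term is at most |b|. *)
  pose a := 1 + 2 * `|b| / `|k|.
  have a1 : 1 <= a by rewrite /a lerDl divr_ge0// mulr_ge0.
  apply: (@integrable_not_bounded_below R d d_gt0 (fun r => f r ^+ 2) fi ((`|k| / 2) ^+ 2) a).
  - by rewrite exprn_gt0// divr_gt0.
  - exact: lt_le_trans a1.
  move=> x ax; have x1 : 1 <= x by rewrite ltW// (le_lt_trans a1).
  have x0 : 0 < x by exact: lt_le_trans x1.
  rewrite normrX lerXn2r ?nnegrE ?divr_ge0// fE//.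
  have bx : `|b / x ^+ d.-1| <= `|b|.
    rewrite normrM ler_piMr// normfV normrX ger0_norm ?(ltW x0)//.
    by rewrite invf_le1 ?exprn_gt0// exprn_ege1.
  have kx : `|b| + `|k| / 2 <= `|k * x|.
    rewrite normrM [`|x|]ger0_norm ?(ltW x0)//.
    have : `|k| * a <= `|k| * x by rewrite ler_wpM2l// ltW.
    have -> : `|k| * a = `|k| + 2 * `|b| by rewrite /a; field; rewrite gt_eqF.
    have := normr_ge0 b; lra.
  have := ler_normB (k * x + b / x ^+ d.-1) (b / x ^+ d.-1); rewrite addrK; lra.
have b0 : b = 0.
  apply/eqP/negPn/negP => b0.
  have B0 : 0 < b ^+ 2 by rewrite exprn_even_gt0.
  have [d1|d3] := d1or3.
    apply: (@integrable_not_bounded_below R d d_gt0 (fun r => f r ^+ 2) fi (b ^+ 2) 1) => // x x1.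
    have x0 : 0 < x by exact: lt_trans x1.
    by rewrite fE// k0 d1 expr0 divr1 mul0r add0r ger0_norm ?sqr_ge0.
  have [M M0 HM] := @integrable_shell_bound R d (fun r => f r ^+ 2) fi.
  have [n dn] : exists n, d = n.+3 by exists (d - 3)%N; rewrite -addn3 subnK.
  pose c := b ^+ 2 / (2 ^+ d.-1) ^+ 2.
  have c0 : 0 < c by rewrite divr_gt0// exprn_gt0// exprn_gt0.
  (* So small that M e < c, whereas the shell bound, multiplied by e^(d-2) <= e, gives c <= M e. *)
  pose e := Num.min 1 (c / (M + 1)).
  have M1 : 0 < M + 1 by rewrite ltr_wpDl.
  have e0 : 0 < e by rewrite lt_min ltr01 divr_gt0.
  have e1 : e <= 1 by rewrite ge_min lexx.
  have e2 : e * (M + 1) <= c by rewrite -ler_pdivlMr// ge_min lexx orbT.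
  have ee : e <= 2 * e by rewrite ler_peMl ?(ltW e0)// ler1n.
  have H : (b / (2 * e) ^+ d.-1) ^+ 2 * ((2 * e) ^+ d - e ^+ d) <= M.
    apply: HM => //; first exact: sqr_ge0.
    move=> x /andP[ex xe]; have x0 : 0 < x by exact: lt_trans ex.
    rewrite fE// k0 mul0r add0r normrX -[X in X <= _]real_normK ?num_real//.
    rewrite lerXn2r ?nnegrE// !normrM ler_wpM2l// !normfV !normrX.
    rewrite lef_pV2 ?posrE ?exprn_gt0 ?normr_gt0 ?gt_eqF ?mulr_gt0//.
    by rewrite lerXn2r ?nnegrE// !ger0_norm ?mulr_ge0 ?(ltW e0) ?(ltW x0).
  have E : (b / (2 * e) ^+ d.-1) ^+ 2 * ((2 * e) ^+ d - e ^+ d) = c * (2 ^+ d - 1) / e ^+ n.+1.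
    rewrite /c dn -[n.+3.-1]/(n.+2) ![(2 * e) ^+ _]exprMn.
    have -> : e ^+ n.+3 = e ^+ n.+2 * e by rewrite exprSr.
    have -> : e ^+ n.+2 = e ^+ n.+1 * e by rewrite exprSr.
    have : e ^+ n.+1 != 0 by rewrite expf_neq0// gt_eqF.
    have : (2 : R) ^+ n.+2 != 0 by rewrite expf_neq0// pnatr_eq0.
    have e3 : e != 0 by rewrite gt_eqF.
    move: (2 ^+ n.+2) (2 ^+ n.+3) (e ^+ n.+1) => p q E p0 E0.
    by field; rewrite p0 E0 e3.
  have d2 : 2 <= 2 ^+ d :> R by apply: ler_eXnr => //; rewrite ler1n.
  have en : e ^+ n.+1 <= e by rewrite -[X in _ <= X]expr1 ler_wiXn2l// ltW.
  move: H; rewrite E ler_pdivrMr ?exprn_gt0// => H.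
  have h1 : c <= c * (2 ^+ d - 1) by rewrite ler_peMr ?(ltW c0)//; lra.
  have h2 : M * e ^+ n.+1 <= M * e by rewrite ler_wpM2l.
  by lra.
by move=> r r0; rewrite fE// k0 b0; ring.
Qed.

Lemma radial_linear1_eq0 (k b : R) : d = 1%N ->
  (leb R d).-integrable setT (fun t => (f (radius t))%:E) ->
  (forall r, 0 < r -> f r = k * r + b) -> forall r, 0 < r -> f r = 0.
Proof.
move=> d1 fi fE.
have k0 : k = 0.
  apply/eqP/negPn/negP => k0; have k1 : 0 < `|k| by rewrite normr_gt0.
  pose a := 1 + `|b| / `|k|.
  have a1 : 1 <= a by rewrite /a lerDl divr_ge0.
  apply: (@integrable_not_bounded_below R d d_gt0 f fi `|k| a) => //.
    exact: lt_le_trans a1.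
  move=> x ax; have x0 : 0 < x by rewrite (lt_trans _ ax)// (lt_le_trans _ a1).
  rewrite fE//.
  have kx : `|b| + `|k| <= `|k * x|.
    rewrite normrM [`|x|]ger0_norm ?(ltW x0)//.
    have : `|k| * a <= `|k| * x by rewrite ler_wpM2l// ltW.
    have -> : `|k| * a = `|k| + `|b| by rewrite /a; field; rewrite gt_eqF.
    lra.
  have := ler_normB (k * x + b) b; rewrite addrK; lra.
have b0 : b = 0.
  apply/eqP/negPn/negP => b0.
  apply: (@integrable_not_bounded_below R d d_gt0 f fi `|b| 1) => //; first by rewrite normr_gt0.
  move=> x x1; have x0 : 0 < x by exact: lt_trans x1.
  by rewrite fE// k0 mul0r add0r.
by move=> r r0; rewrite fE// k0 b0; ring.
Qed.

(** r^(2-d) is integrable at the origin, so unlike the velocity both terms are excluded at infinity: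
    the integral of r^(2-d) over e < r <= 2 e grows like e^2. *)
Lemma radial_harmonic_eq0 (k b : R) : (3 <= d)%N ->
  (leb R d).-integrable setT (fun t => (f (radius t))%:E) ->
  (forall r, 0 < r -> f r = k + b / r ^+ d.-2) -> forall r, 0 < r -> f r = 0.
Proof.
move=> d3 fi fE.
have [n dn] : exists n, d = n.+3 by exists (d - 3)%N; rewrite -addn3 subnK.
have k0 : k = 0.
  apply/eqP/negPn/negP => k0; have k1 : 0 < `|k| by rewrite normr_gt0.
  pose a := 1 + 2 * `|b| / `|k|.
  have a1 : 1 <= a by rewrite /a lerDl divr_ge0// mulr_ge0.
  apply: (@integrable_not_bounded_below R d d_gt0 f fi (`|k| / 2) a).
  - by rewrite divr_gt0.
  - exact: lt_le_trans a1.
  move=> x ax; have x1 : 1 <= x by rewrite ltW// (le_lt_trans a1).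
  have x0 : 0 < x by exact: lt_le_trans x1.
  rewrite fE//.
  have bx : `|b / x ^+ d.-2| <= `|k| / 2.
    rewrite normrM normfV normrX [`|x|]ger0_norm ?(ltW x0)// dn /=.
    apply: (@le_trans _ _ (`|b| / x)).
      rewrite ler_wpM2l// lef_pV2 ?posrE ?exprn_gt0//.
      exact: ler_eXnr.
    rewrite ler_pdivrMr//.
    have : `|k| * a <= `|k| * x by rewrite ler_wpM2l// ltW.
    have -> : `|k| * a = `|k| + 2 * `|b| by rewrite /a; field; rewrite gt_eqF.
    lra.
  have := ler_normB (k + b / x ^+ d.-2) (b / x ^+ d.-2); rewrite addrK; lra.
have b0 : b = 0.
  apply/eqP/negPn/negP => b0; have b1 : 0 < `|b| by rewrite normr_gt0.
  have [M M0 HM] := @integrable_shell_bound R d f fi.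
  pose c := `|b| / 2 ^+ n.+1.
  have c0 : 0 < c by rewrite divr_gt0// exprn_gt0.
  (* Then c e = c + M > M, while the integral over the shell is at least c e^2 >= c e. *)
  pose e := 1 + M / c.
  have Mc : 0 <= M / c by rewrite divr_ge0// ltW.
  have e0 : 0 < e by rewrite /e; lra.
  have ee : e <= 2 * e by rewrite ler_peMl ?(ltW e0)// ler1n.
  have H : `|b| / (2 * e) ^+ n.+1 * ((2 * e) ^+ d - e ^+ d) <= M.
    apply: HM => //; first by rewrite divr_ge0// exprn_ge0// mulr_ge0 ?(ltW e0).
    move=> x /andP[ex xe]; have x0 : 0 < x by exact: lt_trans ex.
    rewrite fE// k0 add0r normrM ler_wpM2l// normfV normrX dn /=.
    rewrite lef_pV2 ?posrE ?exprn_gt0 ?normr_gt0 ?gt_eqF ?mulr_gt0//.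
    by rewrite lerXn2r ?nnegrE// ?ger0_norm ?mulr_ge0 ?(ltW e0) ?(ltW x0).
  have E : `|b| / (2 * e) ^+ n.+1 * ((2 * e) ^+ d - e ^+ d) = c * (2 ^+ d - 1) * e ^+ 2.
    rewrite /c dn !exprMn.
    have -> : e ^+ n.+3 = e ^+ n.+1 * e ^+ 2 by rewrite -exprD addn2.
    have ? : e ^+ n.+1 != 0 by rewrite expf_neq0// gt_eqF.
    have ? : (2 : R) ^+ n.+1 != 0 by rewrite expf_neq0// pnatr_eq0.
    by field; do ?(apply/andP; split).
  have d2 : 2 <= 2 ^+ d :> R by apply: ler_eXnr => //; rewrite ler1n.
  have e2 : e <= e ^+ 2 by apply: ler_eXnr => //; rewrite /e; lra.
  have h1 : c <= c * (2 ^+ d - 1) by rewrite ler_peMr ?(ltW c0)//; lra.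
  have h2 : c * e <= c * (2 ^+ d - 1) * e ^+ 2.
    by apply: ler_pM => //; rewrite ltW.
  have h3 : c * e = c + M by rewrite /e; field; rewrite gt_eqF.
  by move: H; rewrite E; lra.
by move=> r r0; rewrite fE// k0 b0; ring.
Qed.

End radial_odes.

Section radial_profiles.
Context {R : realType} {d : nat}.
Hypothesis d1or3 : d = 1%N \/ (3 <= d)%N.

Let d_gt0 : (0 < d)%N. Proof. by case: d1or3 => [->|/(leq_trans _)->]. Qed.

Let dR : d.-1%:R = d%:R - 1 :> R.
Proof. by rewrite -[in RHS](prednK d_gt0) -natr1 addrK. Qed.

Let is_derive_power (n : nat) (r : R) :
  is_derive r 1 (fun s : R => s ^+ n) (n%:R * r ^+ n.-1).
Proof. by apply: (is_derive_eq (is_derive_pow n (is_derive_id r (1 : R)))); rewrite mulr1. Qed.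

(** [visc_op] is the derivative of the divergence D = U' + (d - 1) U / r. Hence D is a constant k,
    that is (r^(d-1) U)' = k r^(d-1). *)
Lemma stationary_velocity (U : R -> R) :
  (forall r : R, 0 < r -> derivable U r 1) ->
  (forall r : R, 0 < r -> derivable (derive1 U) r 1) ->
  (forall r, 0 < r -> visc_op d U r = 0) ->
  exists k b : R, forall r, 0 < r -> U r = k * r + b / r ^+ d.-1.
Proof.
move=> dU ddU visc0.
pose D (r : R) := derive1 U r + (d%:R - 1) * (U r / r).
have dD (r : R) : 0 < r -> is_derive r 1 D 0.
  move=> r0; have rn : r != 0 by rewrite gt_eqF.
  have dq := is_derive_mul (derivable_derive1 (dU r r0)) (is_derive_inv rn (is_derive_id r (1 : R))).
  apply: (is_derive_eq (is_derive_add (derivable_derive1 (ddU r r0)) (is_derive_cmul (d%:R - 1) dq))).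
  by rewrite -[RHS](visc0 r r0) /visc_op; field.
pose k := D 1.
have Dk (r : R) : 0 < r -> D r = k by move=> r0; exact: (is_derive0_cst dD).
pose F (r : R) := r ^+ d.-1 * U r - k / d%:R * r ^+ d.
have dn : d%:R != 0 :> R by rewrite pnatr_eq0 -lt0n.
have rE (r : R) : r ^+ d = r * r ^+ d.-1 by rewrite -exprS prednK.
have dF (r : R) : 0 < r -> is_derive r 1 F 0.
  move=> r0; have rn : r != 0 by rewrite gt_eqF.
  apply: (is_derive_eq (is_derive_sub
    (is_derive_mul (is_derive_power d.-1 r) (derivable_derive1 (dU r r0)))
    (is_derive_cmul (k / d%:R) (is_derive_power d r)))).
  rewrite -(Dk r r0) /D dR.
  have [d1|d2] := posnP d.-1.
    have dE : d%:R = 1 :> R by rewrite -(prednK d_gt0) d1.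
    by rewrite d1 dE expr0; field.
  have -> : r ^+ d.-1 = r * r ^+ d.-1.-1 by rewrite -exprS prednK.
  by field; apply/andP.
exists (k / d%:R), (F 1) => r r0.
have := is_derive0_cst dF r0 ltr01; rewrite {1}/F => FE.
have ? : r ^+ d.-1 != 0 by rewrite expf_neq0// gt_eqF.
have -> : F 1 = r ^+ d.-1 * U r - k / d%:R * (r * r ^+ d.-1) by rewrite -FE rE.
by field; apply/andP.
Qed.

(** The equation says (r^(d-1) Th')' = 0, so Th' = c r^(1-d); integrating once more gives an affine
    function for d = 1 and a constant plus a multiple of r^(2-d) for d >= 3. *)
Lemma stationary_temperature (Th : R -> R) :
  (forall r : R, 0 < r -> derivable Th r 1) ->
  (forall r : R, 0 < r -> derivable (derive1 Th) r 1) ->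
  (forall r, 0 < r -> derive1 (derive1 Th) r + (d%:R - 1) / r * derive1 Th r = 0) ->
  (leb R d).-integrable setT (fun t => (Th (radius t))%:E) ->
  forall r, 0 < r -> Th r = 0.
Proof.
move=> dTh ddTh lap0 iTh.
pose G (r : R) := r ^+ d.-1 * derive1 Th r.
have dG (r : R) : 0 < r -> is_derive r 1 G 0.
  move=> r0; have rn : r != 0 by rewrite gt_eqF.
  apply: (is_derive_eq (is_derive_mul (is_derive_power d.-1 r) (derivable_derive1 (ddTh r r0)))).
  rewrite -[RHS](mulr0 (r ^+ d.-1)) -(lap0 r r0) dR.
  have [d1|d2] := posnP d.-1.
    have dE : d%:R = 1 :> R by rewrite -(prednK d_gt0) d1.
    by rewrite d1 dE expr0; field.
  have -> : r ^+ d.-1 = r * r ^+ d.-1.-1 by rewrite -exprS prednK.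
  by field.
pose c := G 1.
have Gc (r : R) : 0 < r -> derive1 Th r = c / r ^+ d.-1.
  move=> r0; have rn : r ^+ d.-1 != 0 by rewrite expf_neq0// gt_eqF.
  by rewrite /c -(is_derive0_cst dG r0 ltr01) /G mulrAC mulfV ?mul1r.
have [d1|d3] := d1or3.
  have dF (r : R) : 0 < r -> is_derive r 1 (fun r => Th r - c * r) 0.
    move=> r0; apply: (is_derive_eq (is_derive_sub (derivable_derive1 (dTh r r0))
      (is_derive_cmul c (is_derive_id r (1 : R))))).
    by rewrite Gc// d1 expr0; field.
  apply: (@radial_linear1_eq0 R d d1or3 Th c (Th 1 - c * 1) d1 iTh) => r r0.
  by rewrite -(is_derive0_cst dF r0 ltr01); ring.
have [n dn] : exists n, d = n.+3 by exists (d - 3)%N; rewrite -addn3 subnK.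
have n0 : n.+1%:R != 0 :> R by rewrite pnatr_eq0.
have dF (r : R) : 0 < r -> is_derive r 1 (fun r => Th r + c / n.+1%:R * (r ^+ n.+1)^-1) 0.
  move=> r0; have rn : r != 0 by rewrite gt_eqF.
  have rnn : r ^+ n.+1 != 0 by rewrite expf_neq0.
  apply: (is_derive_eq (is_derive_add (derivable_derive1 (dTh r r0))
    (is_derive_cmul (c / n.+1%:R) (is_derive_inv (f := fun s : R => s ^+ n.+1) rnn (is_derive_power n.+1 r))))).
  rewrite Gc// dn -[n.+3.-1]/(n.+2) -[n.+1.-1]/n.
  have -> : r ^+ n.+2 = r * (r * r ^+ n) by rewrite -!exprS.
  have -> : r ^+ n.+1 = r * r ^+ n by rewrite -exprS.
  have rn' : r ^+ n != 0 by rewrite expf_neq0.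
  move: (r ^+ n) rn' n.+1%:R n0 => p p0 q q0.
  by field; rewrite rn p0 q0.
apply: (@radial_harmonic_eq0 R d d1or3 Th (Th 1 + c / n.+1%:R * (1 ^+ n.+1)^-1) (- (c / n.+1%:R)) d3 iTh) => r r0.
by rewrite -(is_derive0_cst dF r0 ltr01) dn; ring.
Qed.

End radial_profiles.

(* [hvisc] follows from [hmu] and [hlambda] when d > 1.  For d = 1 it rules out
   2 mu + lambda = 0, where P = Th = 0 with an arbitrary bump U solves (cNS). *)
Theorem theorem1p2 (R : realType) (d : nat) (CV Rg kappa mu lambda : R)
  (hd : d = 1%N \/ (3 <= d)%N)
  (hCV : 0 < CV) (hRg : 0 < Rg) (hkappa : 0 < kappa) (hmu : 0 < mu)
  (hlambda : 0 <= 2 * mu + d%:R * lambda)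
  (hvisc : 0 < 2 * mu + lambda)
  (T : R) (hT : 0 < T) (P U Th : R -> R)
  (hP : forall r : R, 0 < r -> 0 <= P r) (hTh : forall r : R, 0 < r -> 0 <= Th r)
  (hsol : selfsimilar_solution d CV Rg kappa mu lambda T P U Th)
  (hTh1 : L1 (fun x : 'rV[R]_d => Th (enorm x)))
  (hPTh : L1 (fun x : 'rV[R]_d => P (enorm x) * Th (enorm x)))
  (hPThU : L1 (fun x : 'rV[R]_d => P (enorm x) * Th (enorm x) * U (enorm x)))
  (hPU2 : L1 (fun x : 'rV[R]_d => P (enorm x) * U (enorm x) ^+ 2))
  (hU : H1 (fun x : 'rV[R]_d => U (enorm x)))
  (hPU3 : (fun eps : R => (eps%:E *
      \int[leb R d]_(t in [set t | (enorm (rvec t) <= eps^-1)%R])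
        (P (enorm (rvec t)) * `|U (enorm (rvec t))| ^+ 3)%R%:E)%E)
    @ 0^'+ --> (0%E : \bar R)) :
  (forall r : R, 0 < r -> U r = 0 /\ Th r = 0) /\
  (exists c : R, forall r : R, 0 < r -> P r = c).

Proof.
have [dreg dode weak] := hsol.
have dP r : 0 < r -> derivable P r 1 by move=> /dreg[].
have dU r : 0 < r -> derivable U r 1 by move=> /dreg[].
have dTh r : 0 < r -> derivable Th r 1 by move=> /dreg[].
have ddU r : 0 < r -> derivable (derive1 U) r 1 by move=> /dreg[].
have ddTh r : 0 < r -> derivable (derive1 Th) r 1 by move=> /dreg[].
have d0 : (0 < d)%N by case: hd => [->|/(leq_trans _)->].
have d2 : d%:R / 2 - 1 != 0 :> R.
  have [->|d3] := hd; first by rewrite subr_eq0 div1r invr_eq1 (eqr_nat _ 2 1).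
  have : 3 <= d%:R :> R by rewrite ler_nat.
  by move=> d3'; rewrite gt_eqF//; lra.
have E0 r : 0 < r -> P r * (U r ^+ 2 / 2 + CV * Th r) = 0.
  exact: (energy_eq0 hT hCV d2 hP hTh dP dU dTh ddU weak hTh1 hPTh hPThU hPU2 hU.1.2 hPU3 d0).
have PU0 r : 0 < r -> P r != 0 -> U r = 0 /\ Th r = 0.
  move=> r0 Pr; have /eqP := E0 r r0; rewrite mulf_eq0 (negbTE Pr)/=.
  rewrite paddr_eq0 ?divr_ge0 ?sqr_ge0 ?mulr_ge0 ?hTh ?(ltW hCV)//.
  move=> /andP[]; rewrite mulf_eq0 invr_eq0 pnatr_eq0 orbF sqrf_eq0 => /eqP ->.
  by rewrite mulf_eq0 (gt_eqF hCV)/= => /eqP ->.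
have PU r : 0 < r -> P r * U r = 0.
  by move=> r0; have [->|/(PU0 r r0)[-> _]] := eqVneq (P r) 0; rewrite ?mul0r ?mulr0.
have dP0 (r : R) : 0 < r -> is_derive r 1 P 0.
  move=> r0; have [mass _ _] := dode r r0.
  have dPr := derivable_derive1 (dP r r0); have dUr := derivable_derive1 (dU r r0).
  (* Since P U vanishes on the whole half-line, so does (P U)' = P' U + P U', and the mass equation
     is left with r P' / 2 = 0. *)
  have dPU : is_derive r 1 (fun s => P s * U s) 0.
    apply: (is_derive_near _ (is_derive_const (0 : R) r 1)).
    by apply: filterS (lt_nbhsr r0) => s /PU ->.
  have PUE : derive1 P r * U r + P r * derive1 U r = 0.
    by rewrite -[LHS](@derive_val _ _ _ _ _ _ _ (is_derive_mul dPr dUr)) derive_val.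
  have r2 : r / 2 * derive1 P r = 0.
    move: mass; rewrite /profile_mass mulrDr addrA -[_ + _ + P r * derive1 U r]addrA PUE addr0.
    by rewrite mulrCA PU// mulr0 addr0.
  move/eqP: r2; rewrite mulf_eq0 gt_eqF ?divr_gt0//= => /eqP P0.
  by rewrite -P0.
have Pc r : 0 < r -> P r = P 1 by move=> r0; exact: (is_derive0_cst dP0).
split; last by exists (P 1).
have [P10|P1] := eqVneq (P 1) 0; last first.
  by move=> r r0; apply: PU0 => //; rewrite Pc.
have P0 r : 0 < r -> P r = 0 by move=> r0; rewrite Pc.
have der0 (f : R -> R) (r : R) : (forall s, 0 < s -> f s = 0) -> 0 < r -> derive1 f r = 0.
  move=> f0 r0; rewrite derive1E; apply: derive_val.
  apply: (is_derive_near _ (is_derive_const (0 : R) r 1)).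
  by apply: filterS (lt_nbhsr r0) => s /f0 ->.
have visc0 r : 0 < r -> visc_op d U r = 0.
  move=> r0; have [_ mom _] := dode r r0; move: mom; rewrite /profile_momentum.
  rewrite !der0//; try by move=> s /P0 ->; rewrite !mul0r.
  rewrite P0// !mul0r !mulr0 !addr0 => /esym/eqP.
  by rewrite mulf_eq0 (gt_eqF hvisc)/= => /eqP.
have [k [b Ukb]] := stationary_velocity hd dU ddU visc0.
have U0 := radial_linear_sqr_eq0 hd hU.1.2 Ukb.
have Th0 : forall r, 0 < r -> Th r = 0.
  apply: (stationary_temperature hd dTh ddTh _ hTh1) => r r0.
  have [_ _ en] := dode r r0; move: en; rewrite /profile_energy.
  have -> : derive1 (fun s => P s * Etot CV U Th s) r = 0.
    by apply: der0 => // s /P0 ->; rewrite mul0r.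
  have -> : derive1 (fun s => U s * P s * Etot CV U Th s + U s * P s * Rg * Th s) r = 0.
    by apply: der0 => // s /P0 ->; rewrite !(mulr0, mul0r) addr0.
  rewrite (@der0 U r U0 r0) visc0// U0// P0//.
  rewrite !(mulr0, mul0r, addr0, add0r, expr0n)/= ?(mulr0, addr0) => /eqP.
  by rewrite oppr_eq0 mulf_eq0 (gt_eqF hkappa)/= => /eqP.
by move=> r r0; rewrite U0// Th0.
Qed.
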